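(* There are exactly 26 Wilf-equivalence classes of quasi-consecutive patterns of length $5$ (patterns $\sigma_1\sigma_2\sigma_3\sigma_4\text{-}\sigma_5$ with $\sigma\in S_5$). They are given by the following list, where each class consists of the listed patterns together with their complements: A: 1254-3, 1354-2. B: 1453-2, 1543-2. C: 2135-4, 2145-3. D: 1534-2. E: 2315-4. F: 1243-5, 1253-4, 2134-5, 2354-1, 3145-2, 3245-1. G: 3125-4, 3215-4. H: 1523-4. I: 3251-4. J: 2154-3. K: 1435-2. L: 3124-5, 3214-5, 2543-1, 2453-1, 2341-5, 2431-5, 1342-5, 1432-5, 1352-4, 1452-3, 1532-4, 1542-3, 2531-4, 2541-3, 2351-4, 2451-3. M: 2153-4, 3154-2. N: 2513-4. O: 1524-3. P: 2415-3. Q: 1325-4. R: 1423-5, 2314-5, 2534-1, 3241-5. S: 2143-5, 3254-1. T: 3152-4. U: 1425-3. V: 1324-5, 2435-1. W: 2514-3. X: 2413-5, 3142-5. Y: 1235-4, 1245-3, 1345-2. Z: 1234-5, 2345-1. That is, two quasi-consecutive patterns of length $5$ are Wilf-equivalent if and only if they lie in the same one of these 26 classes.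
   Context: $S_n$ is the set of permutations of $\{1,\dots,n\}$, written in one-line notation. Two sequences $(a_1,\dots,a_k)$, $(b_1,\dots,b_k)$ of positive integers are order-isomorphic, written $a_1\cdots a_k\sim b_1\cdots b_k$, if for all $1\le i,j\le k$ one has $a_i<a_j$ iff $b_i<b_j$. A quasi-consecutive pattern of length $5$ is written $\sigma_1\sigma_2\sigma_3\sigma_4\text{-}\sigma_5$ with $\sigma=\sigma_1\cdots\sigma_5\in S_5$. A permutation $\pi\in S_n$ contains it if there are indices $1\le i_1<i_2<i_3<i_4<i_5\le n$ with $i_{j+1}=i_j+1$ for $j=1,2,3$ and $\pi_{i_1}\cdots\pi_{i_5}\sim\sigma_1\cdots\sigma_5$ (the first four positions are adjacent, the last one is arbitrary to their right); otherwise $\pi$ avoids it. $S_n(\sigma)$ denotes the set of permutations in $S_n$ avoiding the pattern. Two patterns $\sigma,\tau$ are Wilf-equivalent, $\sigma\equiv\tau$, if $|S_n(\sigma)|=|S_n(\tau)|$ for every positive integer $n$. The complement of $\sigma_1\sigma_2\sigma_3\sigma_4\text{-}\sigma_5$ is $(6-\sigma_1)(6-\sigma_2)(6-\sigma_3)(6-\sigma_4)\text{-}(6-\sigma_5)$. In the list only the lexicographically smaller of each pattern and its complement is recorded, so the list has 60 entries representing all 120 patterns. *)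

(* Defs.v *)
From mathcomp Require Import all_boot all_fingroup.

Set Implicit Arguments.
Unset Strict Implicit.
Unset Printing Implicit Defensive.

(* A permutation of {1, ..., n} is an element of 'S_n, with positions and values
   shifted down by one: position i and value s i of s : 'S_n stand for i.+1 and
   (s i).+1. *)
Definition one_line (n : nat) (s : 'S_n) : seq nat := [seq (s i).+1 | i : 'I_n].

Definition order_iso (k : nat) (a b : 'I_k -> nat) : bool :=
  [forall i, forall j, (a i < a j) == (b i < b j)].

(* f lists the positions i_1 < ... < i_5 of an occurrence of
   s_1 s_2 s_3 s_4 - s_5 in p: the first four of them are adjacent. *)
Definition occurrence (n : nat) (s : 'S_5) (p : 'S_n)
    (f : {ffun 'I_5 -> 'I_n}) : bool :=
  [&& [forall i : 'I_5, forall j : 'I_5, (i < j) ==> (f i < f j)],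
      [forall i : 'I_5, forall j : 'I_5,
         (j == i.+1 :> nat) && (j < 4) ==> (f j == (f i).+1 :> nat)]
    & order_iso (fun k => p (f k)) (fun k => s k)].

Definition contains (n : nat) (s : 'S_5) (p : 'S_n) : bool :=
  [exists f : {ffun 'I_5 -> 'I_n}, occurrence s p f].

Definition avoiders (n : nat) (s : 'S_5) : {set 'S_n} :=
  [set p : 'S_n | ~~ contains s p].

Definition wilf_equiv (s t : 'S_5) : Prop :=
  forall n : nat, 0 < n -> #|avoiders n s| = #|avoiders n t|.

Definition wilf_class (A : {set 'S_5}) : Prop :=
  exists s : 'S_5, forall t : 'S_5, t \in A <-> wilf_equiv s t.

Definition complement (w : seq nat) : seq nat := [seq 6 - a | a <- w].

(* The word abcde stands for the pattern abcd-e; of each pattern and its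
   complement only the lexicographically smaller one is recorded. *)
Definition class_table : seq (seq (seq nat)) := [::
  (* A *) [:: [:: 1; 2; 5; 4; 3]; [:: 1; 3; 5; 4; 2]];
  (* B *) [:: [:: 1; 4; 5; 3; 2]; [:: 1; 5; 4; 3; 2]];
  (* C *) [:: [:: 2; 1; 3; 5; 4]; [:: 2; 1; 4; 5; 3]];
  (* D *) [:: [:: 1; 5; 3; 4; 2]];
  (* E *) [:: [:: 2; 3; 1; 5; 4]];
  (* F *) [:: [:: 1; 2; 4; 3; 5]; [:: 1; 2; 5; 3; 4]; [:: 2; 1; 3; 4; 5];
              [:: 2; 3; 5; 4; 1]; [:: 3; 1; 4; 5; 2]; [:: 3; 2; 4; 5; 1]];
  (* G *) [:: [:: 3; 1; 2; 5; 4]; [:: 3; 2; 1; 5; 4]];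
  (* H *) [:: [:: 1; 5; 2; 3; 4]];
  (* I *) [:: [:: 3; 2; 5; 1; 4]];
  (* J *) [:: [:: 2; 1; 5; 4; 3]];
  (* K *) [:: [:: 1; 4; 3; 5; 2]];
  (* L *) [:: [:: 3; 1; 2; 4; 5]; [:: 3; 2; 1; 4; 5]; [:: 2; 5; 4; 3; 1];
              [:: 2; 4; 5; 3; 1]; [:: 2; 3; 4; 1; 5]; [:: 2; 4; 3; 1; 5];
              [:: 1; 3; 4; 2; 5]; [:: 1; 4; 3; 2; 5]; [:: 1; 3; 5; 2; 4];
              [:: 1; 4; 5; 2; 3]; [:: 1; 5; 3; 2; 4]; [:: 1; 5; 4; 2; 3];
              [:: 2; 5; 3; 1; 4]; [:: 2; 5; 4; 1; 3]; [:: 2; 3; 5; 1; 4];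
              [:: 2; 4; 5; 1; 3]];
  (* M *) [:: [:: 2; 1; 5; 3; 4]; [:: 3; 1; 5; 4; 2]];
  (* N *) [:: [:: 2; 5; 1; 3; 4]];
  (* O *) [:: [:: 1; 5; 2; 4; 3]];
  (* P *) [:: [:: 2; 4; 1; 5; 3]];
  (* Q *) [:: [:: 1; 3; 2; 5; 4]];
  (* R *) [:: [:: 1; 4; 2; 3; 5]; [:: 2; 3; 1; 4; 5]; [:: 2; 5; 3; 4; 1];
              [:: 3; 2; 4; 1; 5]];
  (* S *) [:: [:: 2; 1; 4; 3; 5]; [:: 3; 2; 5; 4; 1]];
  (* T *) [:: [:: 3; 1; 5; 2; 4]];
  (* U *) [:: [:: 1; 4; 2; 5; 3]];
  (* V *) [:: [:: 1; 3; 2; 4; 5]; [:: 2; 4; 3; 5; 1]];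
  (* W *) [:: [:: 2; 5; 1; 4; 3]];
  (* X *) [:: [:: 2; 4; 1; 3; 5]; [:: 3; 1; 4; 2; 5]];
  (* Y *) [:: [:: 1; 2; 3; 5; 4]; [:: 1; 2; 4; 5; 3]; [:: 1; 3; 4; 5; 2]];
  (* Z *) [:: [:: 1; 2; 3; 4; 5]; [:: 2; 3; 4; 5; 1]]
].

Definition table_class (c : seq (seq nat)) : {set 'S_5} :=
  [set s : 'S_5 | one_line s \in c ++ [seq complement w | w <- c]].

Definition listed_classes : {set {set 'S_5}} :=
  [set:: [seq table_class c | c <- class_table]].

(* Main.v *)
Require Import Defs.
From mathcomp Require Import all_boot all_fingroup.
From Stdlib Require Import BinNat.
From mathcomp Require Import zify.

(* Read a permutation from right to left and record each letter by its rank
   among itself and the letters to its right (its Lehmer code).  An occurrence of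
   abcd-e starting at a letter is then a condition on four consecutive code
   entries: the first four letters are in the right order and the gap prescribed
   for the fifth one contains a letter on the right.  Inside a class, the numbers
   of avoiders agree for one of the following reasons.
   - If two occurrences of abcd share at most one letter, then the avoiders with a
     given first letter satisfy a recurrence whose coefficients count the choices
     of b and c between a and d; these coefficients do not change when b and c are
     exchanged, or when e is exchanged with a neighbouring value b or c.
   - For abcd-5, the letters between consecutive right-to-left maxima may be
     reversed or complemented blockwise, which replaces abcd by its reversal or
     its complement.
   - For 1235-4, 1245-3 and 1345-2 (increasing runs of the code) and for 2153-4
     and 3154-2, the recurrences have the same solution, in the last case after a
     cyclic shift of the first letter.
   The numbers of avoiders of length 10 separate the 26 classes. *)

Set Implicit Arguments.
Unset Strict Implicit.
Unset Printing Implicit Defensive.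

(** * Avoidance as a property of words *)

(* [u] is read at the positions of the letters 1, 2, ... of [w]. *)
Definition occurs (w u : seq nat) : bool :=
  sorted ltn [seq nth 0 u (index k w) | k <- iota 1 (size w)].

Definition starts (w p : seq nat) : bool :=
  if p is [:: a, b, c, d & r]
  then has (fun e => occurs w [:: a; b; c; d; e]) r else false.

Fixpoint avoids (w p : seq nat) : bool :=
  if p is _ :: r then ~~ starts w p && avoids w r else true.

Definition nav (w : seq nat) (n : nat) : nat :=
  count (avoids w) (permutations (iota 0 n)).

Lemma avoidsPn w p :
  reflect (exists i j, [/\ i + 3 < j, j < size p &
             occurs w [:: nth 0 p i; nth 0 p i.+1; nth 0 p i.+2;
                          nth 0 p i.+3; nth 0 p j]])
          (~~ avoids w p).
Proof.
elim: p => [|x p IHp] /=; first by constructor=> -[i [j []]].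
rewrite negb_and negbK; apply: (iffP orP).
  case=> [|/IHp[i [j [ij jp occ]]]]; last by exists i.+1, j.+1.
  case: p {IHp} => [|b [|c [|d r]]] //= /(has_nthP 0) [j jr occ].
  by exists 0, j.+4.
case=> i [[|j] [ij jp occ]] //.
case: i ij occ => [|i] ij occ; last by right; apply/IHp; exists i, j.
left; case: j ij jp occ => [|[|[|j]]] // _.
by case: p {IHp} => [|b [|c [|d r]]] //= jr occ; apply/(has_nthP 0); exists j.
Qed.

(** * Permutations as words, and the link with the definitions of the statement *)

Definition word n (p : 'S_n) : seq nat := [seq val (p i) | i <- enum 'I_n].

Lemma size_word n (p : 'S_n) : size (word p) = n.
Proof. by rewrite size_map size_enum_ord. Qed.

Lemma nth_word n (p : 'S_n) (i : 'I_n) : nth 0 (word p) i = p i.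
Proof. by rewrite (nth_map i) ?size_enum_ord // nth_ord_enum. Qed.

Lemma one_lineE n (p : 'S_n) : one_line p = [seq x.+1 | x <- word p].
Proof. by rewrite /word -map_comp. Qed.

Lemma size_one_line n (p : 'S_n) : size (one_line p) = n.
Proof. by rewrite one_lineE size_map size_word. Qed.

Lemma word_inj n : injective (@word n).
Proof.
move=> p q epq; apply/permP => i; apply/val_inj.
by rewrite /= -!nth_word epq.
Qed.

Lemma word_perm_iota n (p : 'S_n) : perm_eq (word p) (iota 0 n).
Proof.
rewrite -val_enum_ord /word map_comp; apply: perm_map.
apply: uniq_perm; rewrite ?enum_uniq //.
  by rewrite map_inj_uniq ?enum_uniq //; apply: perm_inj.
move=> i; rewrite mem_enum; apply/mapP; exists (p^-1 i)%g; rewrite ?mem_enum //.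
by rewrite permKV.
Qed.

(** The words of permutations are distinct members of [permutations (iota 0 n)], and both lists have
    the factorial of [n] as their size. *)
Lemma perm_words n :
  perm_eq (permutations (iota 0 n)) [seq word p | p <- enum 'S_n].
Proof.
have uw : uniq [seq word p | p <- enum 'S_n].
  by rewrite (map_inj_uniq (@word_inj n)) enum_uniq.
have sub : {subset [seq word p | p <- enum 'S_n] <= permutations (iota 0 n)}.
  by move=> _ /mapP [p _ ->]; rewrite mem_permutations word_perm_iota.
rewrite perm_sym; apply: uniq_perm => //; first exact: permutations_uniq.
have le_size : size (permutations (iota 0 n)) <= size [seq word p | p <- enum 'S_n].
  rewrite size_permutations ?iota_uniq // size_iota size_map -cardE.
  by rewrite card_Sn.
by have [] := uniq_min_size uw sub le_size.
Qed.

Lemma index_one_line n (s : 'S_n) (k : 'I_n) : index k.+1 (one_line s) = (s^-1)%g k.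
Proof.
have -> : k.+1 = nth 0 (one_line s) ((s^-1)%g k).
  by rewrite one_lineE (nth_map 0) ?size_word // nth_word permKV.
rewrite index_uniq //; first by rewrite size_one_line.
rewrite one_lineE map_inj_uniq; last exact: succn_inj.
by rewrite (perm_uniq (word_perm_iota s)) iota_uniq.
Qed.

(** Listing [a] by increasing values of [s], that is, composing it with the inverse of [s], turns
    order-isomorphism into strict increase. *)
Lemma order_iso_occurs k (s : 'S_k) (a : 'I_k -> nat) :
  order_iso a (fun i => s i) = occurs (one_line s) [seq a i | i <- enum 'I_k].
Proof.
have nthE (b : 'I_k -> nat) (i : 'I_k) : nth 0 [seq b i | i <- enum 'I_k] i = b i.
  by rewrite (nth_map i) ?size_enum_ord // nth_ord_enum.
set b := fun i => a ((s^-1)%g i).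
have -> : occurs (one_line s) [seq a i | i <- enum 'I_k]
        = pairwise ltn [seq b i | i <- enum 'I_k].
  rewrite /occurs sorted_pairwise; last exact: ltn_trans.
  have -> : iota 1 (size (one_line s)) = [seq (val i).+1 | i <- enum 'I_k].
    by rewrite size_one_line -[1]addn0 iotaDl -val_enum_ord -map_comp.
  congr pairwise; rewrite -[LHS]map_comp; apply: eq_map => i /=.
  by rewrite index_one_line nthE.
apply/forallP/(pairwiseP 0); rewrite size_map size_enum_ord.
  move=> iso i j ik jk ij.
  suff: b (Ordinal ik) < b (Ordinal jk).
    by move: (nthE b (Ordinal ik)) (nthE b (Ordinal jk)) => /= -> ->.
  have := iso ((s^-1)%g (Ordinal ik)) => /forallP /(_ ((s^-1)%g (Ordinal jk))).
  by rewrite !permKV /= ij eqb_id.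
move=> mono i; apply/forallP => j.
have lt_b (x y : 'I_k) : x < y -> b x < b y.
  by move=> xy; rewrite -(nthE b x) -(nthE b y); apply: mono => //; apply: ltn_ord.
have aE x : a x = b (s x) by rewrite /b permK.
rewrite !aE; case: (ltngtP (s i) (s j)) => [/lt_b -> //|/lt_b|/val_inj ->].
  by move=> /ltnW; rewrite leqNgt => /negbTE ->.
by rewrite ltnn.
Qed.

Lemma map_enum_ord5 (T : Type) (b : 'I_5 -> T) :
  [seq b i | i <- enum 'I_5] =
  [:: b (@Ordinal 5 0 isT); b (@Ordinal 5 1 isT); b (@Ordinal 5 2 isT);
      b (@Ordinal 5 3 isT); b (@Ordinal 5 4 isT)].
Proof.
have -> : enum 'I_5 = [:: @Ordinal 5 0 isT; @Ordinal 5 1 isT; @Ordinal 5 2 isT;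
                          @Ordinal 5 3 isT; @Ordinal 5 4 isT] => //.
by apply: (inj_map val_inj); rewrite val_enum_ord.
Qed.

Lemma containsE n (s : 'S_5) (p : 'S_n) :
  contains s p = ~~ avoids (one_line s) (word p).
Proof.
apply/existsP/avoidsPn.
  move=> [f /and3P [/forallP mono /forallP adj]].
  rewrite order_iso_occurs map_enum_ord5 => occ.
  have lt_f i j (i5 : i < 5) (j5 : j < 5) : i < j -> f (Ordinal i5) < f (Ordinal j5).
    by move=> ij; have /forallP /(_ (Ordinal j5)) := mono (Ordinal i5); rewrite ij.
  have eq_f i (i5 : i < 5) (j5 : i.+1 < 5) :
      i < 3 -> f (Ordinal j5) = (f (Ordinal i5)).+1 :> nat.
    move=> i3; have /forallP /(_ (Ordinal j5)) := adj (Ordinal i5).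
    by rewrite /= eqxx ltnS i3 => /eqP.
  have f1 := eq_f 0 isT isT isT; have f2 := eq_f 1 isT isT isT.
  have f3 := eq_f 2 isT isT isT.
  exists (f (@Ordinal 5 0 isT)), (f (@Ordinal 5 4 isT)); rewrite size_word; split => //.
    by rewrite addn3 -f1 -f2 -f3 lt_f.
  by rewrite -f1 -f2 -f3 !nth_word.
rewrite size_word => -[i [j [ij jn occ]]].
(* The five positions are recovered from the start [i] of the adjacent block and the position [j] of
   the last letter. *)
pose g k := if k < 4 then i + k else j.
have g_lt k : g k < n by rewrite /g; case: ifP; lia.
pose f := [ffun k : 'I_5 => Ordinal (g_lt k)].
exists f; apply/and3P; split.
- apply/forallP => k; apply/forallP => l; apply/implyP => kl.
  by rewrite !ffunE /= /g; have := ltn_ord l; do 2 case: ifP; lia.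
- apply/forallP => k; apply/forallP => l; apply/implyP => /andP [/eqP lk l4].
  have k4 : k < 4 by rewrite (ltn_trans _ l4) ?lk.
  by rewrite !ffunE /= /g l4 k4 lk addnS.
- rewrite order_iso_occurs map_enum_ord5 -!nth_word !ffunE /=.
  by rewrite /g /= addn0 addn1 addn2 addn3.
Qed.

Lemma card_avoiders n (s : 'S_5) : #|avoiders n s| = nav (one_line s) n.
Proof.
rewrite /nav (seq.permP (perm_words n)) count_map enumT cardE size_filter.
by apply: eq_count => p; rewrite /= !inE containsE negbK.
Qed.

(** * Order-preserving and order-reversing maps *)

Lemma perm_map_endo (T : eqType) (s : seq T) (f : T -> T) :
  uniq s -> {in s &, injective f} -> {in s, forall x, f x \in s} ->
  perm_eq [seq f x | x <- s] s.
Proof.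
move=> us inj_f sf.
have uf : uniq [seq f x | x <- s] by rewrite map_inj_in_uniq.
apply: uniq_perm => //.
have sub : {subset [seq f x | x <- s] <= s} by move=> _ /mapP [x /sf xs ->].
by have [|_ //] := uniq_min_size uf sub; rewrite size_map.
Qed.

(** The hypothesis is restricted to letters of [p], so that it also applies to a [g] that reverses
    the order on these letters only. *)
Lemma avoids_map w w' (g : nat -> nat) p :
  (forall u, size u = 5 -> {subset u <= p} -> occurs w' (map g u) = occurs w u) ->
  avoids w' (map g p) = avoids w p.
Proof.
elim: p => [//|x p IHp] occE /=; congr (~~ _ && _); last first.
  by apply: IHp => u u5 up; apply: occE => // y /up; rewrite inE orbC => ->.
case: p {IHp} occE => [|b [|c [|d r]]] //= occE.
rewrite has_map; apply: eq_in_has => e er /=.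
rewrite -(occE [:: x; b; c; d; e]) // => y; rewrite !inE.
by move=> /or4P [->|->|->|/orP [->|/eqP ->]]; rewrite ?er ?orbT.
Qed.

Lemma uniq_mem_pattern (w : seq nat) :
  perm_eq w (iota 1 (size w)) -> uniq w * (w =i iota 1 (size w)).
Proof. by move=> wP; split; [rewrite (perm_uniq wP) iota_uniq|exact: perm_mem]. Qed.

Lemma mem_occurs_seq (w u : seq nat) x : perm_eq w (iota 1 (size w)) -> size u = size w ->
  x \in [seq nth 0 u (index k w) | k <- iota 1 (size w)] -> x \in u.
Proof.
move=> /uniq_mem_pattern [_ mw] su /mapP [k]; rewrite -mw => kw ->.
by rewrite mem_nth // su index_mem.
Qed.

Lemma occurs_mono (w u : seq nat) (g : nat -> nat) :
  perm_eq w (iota 1 (size w)) -> size u = size w ->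
  {in u &, forall x y, (g x < g y) = (x < y)} ->
  occurs w (map g u) = occurs w u.
Proof.
move=> wP su gu; have [_ mw] := uniq_mem_pattern wP; rewrite /occurs.
have -> : [seq nth 0 (map g u) (index k w) | k <- iota 1 (size w)] =
          map g [seq nth 0 u (index k w) | k <- iota 1 (size w)].
  rewrite -map_comp; apply/eq_in_map => k; rewrite -mw => kw /=.
  by rewrite (nth_map 0) // su index_mem.
rewrite sorted_map; apply: eq_in_sorted; last first.
  by apply/allP => x; apply: mem_occurs_seq.
by move=> x y xu yu /=; rewrite gu.
Qed.

Lemma index_map_in (T1 T2 : eqType) (f : T1 -> T2) (s : seq T1) x :
  {in s, forall y, f y = f x -> y = x} -> index (f x) (map f s) = index x s.
Proof.
elim: s => //= y s IHs inj_x; rewrite IHs => [|z zs]; last first.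
  by apply: inj_x; rewrite inE zs orbT.
congr (if _ then _ else _); apply/eqP/eqP => [|-> //].
by apply: inj_x; rewrite inE eqxx.
Qed.

Definition compl w := [seq (size w).+1 - x | x <- w].

Lemma occurs_anti (w u : seq nat) (g : nat -> nat) :
  perm_eq w (iota 1 (size w)) -> size u = size w ->
  {in u &, forall x y, (g x < g y) = (y < x)} ->
  occurs (compl w) (map g u) = occurs w u.
Proof.
move=> wP su gu; have [_ mw] := uniq_mem_pattern wP; rewrite /occurs size_map.
set l := [seq nth 0 u (index k w) | k <- iota 1 (size w)].
have -> : [seq nth 0 (map g u) (index k (compl w)) | k <- iota 1 (size w)] =
          rev (map g l).
  (* Complementing the values 1, ..., [size w] lists them backwards; the order-reversing [g] makes
     up for this reversal. *)
  have iE : iota 1 (size w) = rev [seq (size w).+1 - k | k <- iota 1 (size w)].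
    apply: (@eq_from_nth _ 0); rewrite ?size_rev ?size_map // size_iota => i ilt.
    by rewrite nth_rev ?size_map ?size_iota // (nth_map 0) ?size_iota ?nth_iota; lia.
  rewrite {1}iE map_rev -!map_comp; congr rev; apply/eq_in_map => k /=.
  rewrite -mw => kw; rewrite -(nth_map 0 0 g) ?su ?index_mem //; congr nth.
  have sub_inj (m i j : nat) : 0 < i < 1 + m -> 0 < j < 1 + m ->
    m.+1 - j = m.+1 - i -> j = i by lia.
  by apply: index_map_in => y; move: kw; rewrite !mw !mem_iota; apply: sub_inj.
rewrite rev_sorted sorted_map; apply: eq_in_sorted; last first.
  by apply/allP => x; apply: mem_occurs_seq.
by move=> x y xu yu /=; rewrite gu.
Qed.

Lemma occurs_rev (w u : seq nat) :
  perm_eq w (iota 1 (size w)) -> size u = size w ->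
  occurs (rev w) (rev u) = occurs w u.
Proof.
move=> wP su; have [uw mw] := uniq_mem_pattern wP; rewrite /occurs size_rev.
congr sorted; apply/eq_in_map => k; rewrite -mw => kw.
have lt_k : index k w < size w by rewrite index_mem.
set j := size w - (index k w).+1.
have lt_j : j < size w by lia.
have jE : size w - j.+1 = index k w by lia.
have kE : k = nth 0 (rev w) j by rewrite nth_rev // jE nth_index.
rewrite {1}kE index_uniq ?rev_uniq ?size_rev //.
by rewrite nth_rev su ?jE.
Qed.

Lemma nav_complement w n : perm_eq w (iota 1 5) -> nav (complement w) n = nav w n.
Proof.
move=> wP; have sw : size w = 5 by rewrite (perm_size wP).
have -> : complement w = compl w by rewrite /compl sw.
pose g x := n.-1 - x.
have gP : {in permutations (iota 0 n), forall p, map g p \in permutations (iota 0 n)}.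
  move=> p; rewrite !mem_permutations => pP.
  apply: perm_trans (perm_map g pP) _; apply: perm_map_endo; rewrite ?iota_uniq //.
    by move=> x y; rewrite !mem_iota /g; lia.
  by move=> x; rewrite !mem_iota /g; lia.
have perm_g : perm_eq [seq map g p | p <- permutations (iota 0 n)]
                      (permutations (iota 0 n)).
  apply: perm_map_endo => //; first exact: permutations_uniq.
  move=> p q; rewrite !mem_permutations => /perm_mem mp /perm_mem mq.
  have gK x : x \in iota 0 n -> g (g x) = x by rewrite mem_iota /g; lia.
  move=> /(congr1 (map g)); rewrite -!map_comp.
  by rewrite !map_id_in // => x; rewrite ?mp ?mq => /gK.
rewrite /nav -(seq.permP perm_g) count_map; apply: eq_in_count => p.
rewrite mem_permutations => /perm_mem mp /=; apply: avoids_map => u u5 up.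
apply: occurs_anti; rewrite ?sw // => x y /up; rewrite mp mem_iota => xn /up.
by rewrite mp mem_iota /g; lia.
Qed.

(** * Blocks between right-to-left maxima *)

(** Plain consecutive avoidance: this is what abcd-5 demands of the letters before the maximum,
    which always supplies the fifth letter. *)
Fixpoint consec_avoids (w p : seq nat) : bool :=
  if p is _ :: r then
    ~~ ((size w <= size p) && occurs w (take (size w) p)) && consec_avoids w r
  else true.

Lemma consec_avoidsPn w p : 0 < size w ->
  reflect (exists p1 u p2, [/\ p = p1 ++ u ++ p2, size u = size w & occurs w u])
          (~~ consec_avoids w p).
Proof.
move=> w_gt0; elim: p => [|x p IHp] /=.
  constructor=> -[p1 [u [p2 [/(congr1 size) pE su _]]]].
  by move: pE; rewrite !size_cat su /=; lia.
rewrite negb_and negbK; apply: (iffP orP).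
  case=> [/andP [le_wp occ]|/IHp [p1 [u [p2 [-> su occ]]]]].
    exists [::], (take (size w) (x :: p)), (drop (size w) (x :: p)).
    by rewrite cat_take_drop size_takel.
  by exists (x :: p1), u, p2.
case=> [[|y p1] [u [p2 [/= pE su occ]]]]; last first.
  by case: pE => _ pE; right; apply/IHp; exists p1, u, p2.
left; rewrite pE -su take_size_cat // occ andbT.
by rewrite -[(size p).+1]/(size (x :: p)) pE size_cat leq_addr.
Qed.

Lemma occurs_rcons5 w a b c d e : perm_eq w (iota 1 4) ->
  occurs (rcons w 5) [:: a; b; c; d; e] =
  occurs w [:: a; b; c; d] && [&& a < e, b < e, c < e & d < e].
Proof.
rewrite -mem_permutations.
have -> : permutations (iota 1 4) = ltac:(let l := eval vm_compute in
  (permutations (iota 1 4)) in exact l) by vm_compute.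
(* The 24 possible [w] are taken one by one; each leaves a statement of linear arithmetic. *)
by rewrite !inE; do 23?[case/orP=> [/eqP ->|]]; last move=> /eqP ->;
  rewrite /occurs /=; lia.
Qed.

(* An occurrence of [w] that lies before [m] is completed by [m]; otherwise it
   lies after [m], since [m] is too large to be one of its letters. *)
Lemma avoids_rcons5_cat w L m R : perm_eq w (iota 1 4) ->
  all (ltn^~ m) (L ++ R) ->
  avoids (rcons w 5) (L ++ m :: R) = consec_avoids w L && avoids (rcons w 5) R.
Proof.
move=> wP; have sw : size w = 4 by rewrite (perm_size wP).
have has_occ a b c d r : has (fun e => occurs (rcons w 5) [:: a; b; c; d; e]) r =
  occurs w [:: a; b; c; d] && has (fun e => [&& a < e, b < e, c < e & d < e]) r.
  case: (boolP (occurs w _)) => occ /=; last first.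
    by apply/hasPn => e _; rewrite occurs_rcons5 // (negbTE occ).
  by apply: eq_has => e; rewrite occurs_rcons5 // occ.
(* If [m] is among the four adjacent letters, the fifth letter would have to exceed [m], but all
   letters to the right are smaller. *)
have not_has a b c d r : all (ltn^~ m) r -> [|| a == m, b == m, c == m | d == m] ->
    has (fun e => [&& a < e, b < e, c < e & d < e]) r = false.
  by move=> /allP rm eqm; apply/hasPn => e /rm /=; lia.
have avoids_cons v y q : avoids v (y :: q) = ~~ starts v (y :: q) && avoids v q by [].
elim: L => [|x L IHL] /=; rewrite -avoids_cons.
  move=> Rm; rewrite avoids_cons (_ : starts _ _ = false) //.
  case: R Rm => [|b [|c [|d r]]] //= /and4P [_ _ _ rm].
  by rewrite has_occ not_has ?eqxx // andbF.
move=> /andP [xm Lm]; rewrite avoids_cons IHL // andbA; congr (_ && _ && _); rewrite sw.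
case: L Lm {IHL} => [|b [|c [|d L]]] /=.
- by case: R => [|c [|d r]] //= /and3P [_ _ rm]; rewrite has_occ not_has ?eqxx ?orbT //
  andbF.
- by case: R => [|d r] //= /and3P [_ _ rm]; rewrite has_occ not_has ?eqxx ?orbT //
  andbF.
- by move=> /and3P [_ _ rm]; rewrite has_occ not_has ?eqxx ?orbT //
  andbF.
(* All four letters precede [m], which can serve as the fifth. *)
move=> /and4P [bm cm dm _]; rewrite take0 has_occ has_cat /= xm bm cm dm.
by rewrite orbT andbT.
Qed.

(** [k] is fuel, sufficient once it is at least [size p]. Cutting at the maximum and recursing on
    what follows it cuts [p] at its right-to-left maxima; [psi] acts on the blocks in between. *)
Fixpoint block_map (psi : seq nat -> seq nat) k p : seq nat :=
  if k is k.+1 then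
    if p is [::] then [::] else
    let m := \max_(x <- p) x in
    psi (take (index m p) p) ++ m :: block_map psi k (drop (index m p).+1 p)
  else [::].

Lemma bigmax_mem (p : seq nat) : p != [::] -> \max_(x <- p) x \in p.
Proof.
elim: p => // x [|y p] IHp _; first by rewrite big_seq1 inE.
rewrite big_cons inE /maxn; case: ifP => _; last by rewrite eqxx.
by rewrite IHp ?orbT.
Qed.

Lemma bigmax_split (p : seq nat) : uniq p -> p != [::] ->
  exists (L : seq nat) (m : nat) (R : seq nat),
    [/\ p = L ++ m :: R, uniq L, uniq R & all (ltn^~ m) (L ++ R)].
Proof.
move=> up /bigmax_mem; set m := \max_(x <- p) x => mp.
have max_m x : x \in p -> x <= m by move=> xp; apply: leq_bigmax_seq.
case/splitPr: mp up max_m => L R.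
rewrite cat_uniq /= => /and4P [uL /norP [mL _] mR uR] max_m.
exists L, m, R; split=> //; apply/allP => x; rewrite mem_cat => xLR.
rewrite /= ltn_neqAle max_m ?andbT; first last.
  by rewrite mem_cat inE orbCA xLR orbT.
by apply: contraTneq xLR => ->; rewrite negb_or mL.
Qed.

Lemma block_map_cat psi k (L : seq nat) m R : all (ltn^~ m) (L ++ R) ->
  block_map psi k.+1 (L ++ m :: R) = psi L ++ m :: block_map psi k R.
Proof.
rewrite all_cat => /andP [/allP Lm /allP Rm].
have mE : \max_(x <- L ++ m :: R) x = m.
  apply/eqP; rewrite eqn_leq leq_bigmax_seq ?andbT //; last first.
    by rewrite mem_cat inE eqxx orbT.
  apply/bigmax_leqP_seq => x; rewrite mem_cat inE.
  by move=> /or3P [/Lm /ltnW|/eqP ->|/Rm /ltnW].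
have iE : index m (L ++ m :: R) = size L.
  rewrite index_cat /= eqxx addn0; case: ifP => // /Lm; by rewrite /= ltnn.
rewrite /=; case E: (L ++ m :: R) => [|y s]; first by case: L E {mE iE Lm}.
rewrite -E mE iE take_size_cat // drop_cat ltnNge leqnSn subSnn /=.
by rewrite drop0.
Qed.

Section BlockMap.

Variable psi : seq nat -> seq nat.
Hypothesis psi_perm : forall p : seq nat, uniq p -> perm_eq (psi p) p.
Hypothesis psiK : forall p : seq nat, uniq p -> psi (psi p) = p.

Lemma block_map_perm k (p : seq nat) :
  uniq p -> size p <= k -> perm_eq (block_map psi k p) p.
Proof.
elim: k p => [|k IHk] p up; first by rewrite leqn0 size_eq0 => /eqP ->.
case: (eqVneq p [::]) => [-> //|/(bigmax_split up) [L [m [R [-> uL uR LRm]]]]].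
rewrite size_cat [size (_ :: _)]/= => size_p; rewrite block_map_cat //.
apply: perm_cat; first exact: psi_perm.
by rewrite perm_cons; apply: IHk => //; lia.
Qed.

(** [psi] keeps the letters of each block, so the second pass cuts the word at the same maxima. *)
Lemma block_mapK k (p : seq nat) :
  uniq p -> size p <= k -> block_map psi k (block_map psi k p) = p.
Proof.
elim: k p => [|k IHk] p up; first by rewrite leqn0 size_eq0 => /eqP ->.
case: (eqVneq p [::]) => [-> //|/(bigmax_split up) [L [m [R [-> uL uR LRm]]]]].
rewrite size_cat [size (_ :: _)]/= => size_p.
rewrite block_map_cat // block_map_cat; last first.
  have pR : perm_eq (block_map psi k R) R by apply: block_map_perm => //; lia.
  by rewrite (perm_all _ (perm_cat (psi_perm uL) pR)).
by rewrite psiK // IHk //; lia.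
Qed.

Lemma block_map_avoids w w' k (p : seq nat) :
  perm_eq w (iota 1 4) -> perm_eq w' (iota 1 4) ->
  (forall q : seq nat, uniq q -> consec_avoids w' (psi q) = consec_avoids w q) ->
  uniq p -> size p <= k ->
  avoids (rcons w' 5) (block_map psi k p) = avoids (rcons w 5) p.
Proof.
move=> wP wP' psiE; elim: k p => [|k IHk] p up.
  by rewrite leqn0 size_eq0 => /eqP ->.
case: (eqVneq p [::]) => [-> //|/(bigmax_split up) [L [m [R [-> uL uR LRm]]]]].
rewrite size_cat [size (_ :: _)]/= => size_p.
rewrite block_map_cat // !avoids_rcons5_cat //.
  by rewrite psiE // IHk //; lia.
have pR : perm_eq (block_map psi k R) R by apply: block_map_perm => //; lia.
by rewrite (perm_all _ (perm_cat (psi_perm uL) pR)).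
Qed.

Lemma nav_block w w' n : perm_eq w (iota 1 4) -> perm_eq w' (iota 1 4) ->
  (forall q : seq nat, uniq q -> consec_avoids w' (psi q) = consec_avoids w q) ->
  nav (rcons w' 5) n = nav (rcons w 5) n.
Proof.
move=> wP wP' psiE.
have permP p : p \in permutations (iota 0 n) -> uniq p /\ size p <= n.
  rewrite mem_permutations => pP.
  by rewrite (perm_uniq pP) iota_uniq (perm_size pP) size_iota.
have perm_f : perm_eq [seq block_map psi n p | p <- permutations (iota 0 n)]
                      (permutations (iota 0 n)).
  apply: perm_map_endo; first exact: permutations_uniq.
    move=> p q /permP [up sp] /permP [uq sq] /(congr1 (block_map psi n)).
    by rewrite !block_mapK.
  move=> p pP; have [up sp] := permP p pP.
  by move: pP; rewrite !mem_permutations; apply: perm_trans; apply: block_map_perm.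
rewrite /nav -(seq.permP perm_f) count_map; apply: eq_in_count => p /permP [up sp] /=.
exact: block_map_avoids.
Qed.

End BlockMap.

(** * Two involutions on blocks: reversal and complementation *)

Lemma nav_rev w n : perm_eq w (iota 1 4) ->
  nav (rcons (rev w) 5) n = nav (rcons w 5) n.
Proof.
move=> wP; have sw : size w = 4 by rewrite (perm_size wP).
apply: (@nav_block rev) => //.
- by move=> p _; rewrite perm_rev.
- by move=> p _; rewrite revK.
- by rewrite perm_rev.
(* One implication is enough, since reversal is an involution on patterns and on words. *)
have half v q : size v = 4 -> perm_eq v (iota 1 4) ->
    ~~ consec_avoids v q -> ~~ consec_avoids (rev v) (rev q).
  move=> sv vP /consec_avoidsPn [|p1 [u [p2 [-> su occ]]]]; first by rewrite sv.
  apply/consec_avoidsPn; first by rewrite size_rev sv.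
  exists (rev p2), (rev u), (rev p1); rewrite !rev_cat catA !size_rev su; split=> //.
  by rewrite occurs_rev // sv.
move=> q _; apply/negb_inj; apply/idP/idP; last exact: half.
by rewrite -{2}(revK w) -{2}(revK q); apply: half; rewrite ?size_rev ?perm_rev.
Qed.

(* The order-reversing permutation of the set of letters of [p]. *)
Definition flip (p : seq nat) (x : nat) : nat :=
  nth 0 (rev (sort leq p)) (index x (sort leq p)).

Section Flip.

Variable p : seq nat.
Hypothesis up : uniq p.

Let us : uniq (sort leq p). Proof. by rewrite sort_uniq. Qed.

Lemma index_sort_lt x : x \in p -> index x (sort leq p) < size p.
Proof. by rewrite -(mem_sort leq) -index_mem size_sort. Qed.

Lemma flipE x : x \in p ->
  flip p x = nth 0 (sort leq p) (size p - (index x (sort leq p)).+1).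
Proof. by move=> xp; rewrite /flip nth_rev size_sort // index_sort_lt. Qed.

Lemma nth_sort_lt i j : i < size p -> j < size p ->
  (nth 0 (sort leq p) i < nth 0 (sort leq p) j) = (i < j).
Proof.
have /(sorted_ltn_nth ltn_trans 0) mono : sorted ltn (sort leq p).
  by rewrite ltn_sorted_uniq_leq us sort_sorted //; apply: leq_total.
move=> ip jp; case: (ltngtP i j) => [ij|ji|->]; last by rewrite ltnn.
  by rewrite mono ?inE ?size_sort.
by apply/negbTE; rewrite -leqNgt ltnW // mono ?inE ?size_sort.
Qed.

Lemma flip_anti : {in p &, forall x y, (flip p x < flip p y) = (y < x)}.
Proof.
move=> x y xp yp; have ix := index_sort_lt xp; have iy := index_sort_lt yp.
rewrite !flipE // nth_sort_lt; try lia.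
rewrite -[in RHS](@nth_index _ 0 x (sort leq p)) ?mem_sort //.
rewrite -[in RHS](@nth_index _ 0 y (sort leq p)) ?mem_sort //.
by rewrite nth_sort_lt //; lia.
Qed.

Lemma flip_mem : {in p, forall x, flip p x \in p}.
Proof.
move=> x xp; have ix := index_sort_lt xp.
rewrite flipE // -[_ \in p](mem_sort leq) mem_nth // size_sort.
by rewrite ltn_subrL (leq_ltn_trans _ ix).
Qed.

Lemma flipK : {in p, forall x, flip p (flip p x) = x}.
Proof.
move=> x xp; have ix := index_sort_lt xp.
rewrite (flipE (flip_mem xp)) (flipE xp); set j := size p - (index x _).+1.
have lt_j : j < size (sort leq p) by rewrite size_sort /j; lia.
rewrite (index_uniq 0 lt_j us) (_ : size p - j.+1 = index x (sort leq p)).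
  by rewrite nth_index ?mem_sort.
by rewrite /j; lia.
Qed.

Lemma perm_map_flip : perm_eq (map (flip p) p) p.
Proof.
apply: perm_map_endo => //; last exact: flip_mem.
by move=> x y xp yp /(congr1 (flip p)); rewrite !flipK.
Qed.

(** [flip p] depends only on the set of letters of [p], which [map (flip p) p] shares. *)
Lemma map_flipK : map (flip (map (flip p) p)) (map (flip p) p) = p.
Proof.
have flip_flip : flip (map (flip p) p) =1 flip p.
  rewrite /flip; have /perm_sortP -> // : perm_eq (map (flip p) p) p.
    exact: perm_map_flip.
  - exact: leq_total.
  - exact: leq_trans.
  - exact: anti_leq.
rewrite -map_comp map_id_in // => x xp /=.
by rewrite flip_flip flipK.
Qed.

End Flip.

(** Each block is complemented within its own set of letters, so that the right-to-left maxima stay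
    in place. *)
Lemma nav_compl w n : perm_eq w (iota 1 4) ->
  nav (rcons (compl w) 5) n = nav (rcons w 5) n.
Proof.
have complP v : perm_eq v (iota 1 4) -> perm_eq (compl v) (iota 1 4).
  move=> vP; have sv : size v = 4 by rewrite (perm_size vP).
  by rewrite /compl sv (perm_trans (perm_map _ vP)).
have complK v : perm_eq v (iota 1 4) -> compl (compl v) = v.
  move=> vP; have sv : size v = 4 by rewrite (perm_size vP).
  rewrite /compl size_map sv -map_comp map_id_in // => x.
  by rewrite (perm_mem vP) mem_iota /=; lia.
move=> wP; have sw : size w = 4 by rewrite (perm_size wP).
apply: (@nav_block (fun p => map (flip p) p)) => //.
- exact: perm_map_flip.
- exact: map_flipK.
- exact: complP.
have half v q : perm_eq v (iota 1 4) -> uniq q ->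
    ~~ consec_avoids v q -> ~~ consec_avoids (compl v) (map (flip q) q).
  move=> vP uq; have sv : size v = 4 by rewrite (perm_size vP).
  move=> /consec_avoidsPn [|p1 [u [p2 [qE su occ]]]]; first by rewrite sv.
  apply/consec_avoidsPn; first by rewrite size_map sv.
  exists (map (flip q) p1), (map (flip q) u), (map (flip q) p2).
  rewrite -!map_cat -qE !size_map su; split=> //.
  rewrite occurs_anti ?su ?sv // => x y xu yu; apply: flip_anti => //;
    by rewrite qE !mem_cat ?xu ?yu orbT.
move=> q uq; apply/negb_inj; apply/idP/idP; last exact: half.
have uf : uniq (map (flip q) q) by rewrite (perm_uniq (perm_map_flip uq)).
by have := half _ _ (complP _ wP) uf; rewrite complK // map_flipK.
Qed.

(** * Lehmer codes *)

Fixpoint decode (c : seq nat) : seq nat :=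
  if c is x :: r then x :: map (bump x) (decode r) else [::].

Fixpoint codes (n : nat) : seq (seq nat) :=
  if n is m.+1 then [seq x :: r | x <- iota 0 n, r <- codes m] else [:: [::]].

Lemma mem_codes_cons n x c : (x :: c \in codes n.+1) = (x < n.+1) && (c \in codes n).
Proof.
apply/allpairsP/andP => [[[y r] [yn rn [-> ->]]]|[xn cn]].
  by move: yn; rewrite mem_iota.
by exists (x, c); rewrite mem_iota.
Qed.

Lemma size_codes n : size (codes n) = n`!.
Proof. by elim: n => // n IHn; rewrite size_allpairs IHn size_iota factS. Qed.

Lemma uniq_codes n : uniq (codes n).
Proof.
elim: n => // n IHn; apply: allpairs_uniq => //; first exact: iota_uniq.
by move=> [x1 c1] [x2 c2] _ _ /= [-> ->].
Qed.

Lemma decode_inj : injective decode.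
Proof.
elim=> [|x c IHc] [|y d] //= [<- /inj_map cd].
by rewrite (IHc d) // cd //; apply: can_inj (bumpK x).
Qed.

Lemma perm_bump_iota x n : x <= n ->
  perm_eq (x :: map (bump x) (iota 0 n)) (iota 0 n.+1).
Proof.
move=> xn; have ub : uniq (x :: map (bump x) (iota 0 n)).
  rewrite /= (map_inj_uniq (can_inj (bumpK x))) iota_uniq andbT.
  by apply/mapP => -[y _]; rewrite /bump; lia.
apply: uniq_perm => //; first exact: iota_uniq.
apply: (uniq_min_size ub _ _).2; last by rewrite /= size_map !size_iota.
move=> y; rewrite inE => /orP [/eqP ->|/mapP [z]]; rewrite !mem_iota; first by lia.
by move=> zn ->; rewrite /bump; lia.
Qed.

Lemma decode_perm n c : c \in codes n -> perm_eq (decode c) (iota 0 n).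
Proof.
elim: n c => [|n IHn] [|x c] //; first by move/allpairsP => [? []].
rewrite mem_codes_cons ltnS => /andP [xn /IHn cn].
apply: (perm_trans _ (perm_bump_iota xn)); rewrite /= perm_cons.
exact: perm_map.
Qed.

Lemma perm_codes n : perm_eq (permutations (iota 0 n)) (map decode (codes n)).
Proof.
have uc : uniq (map decode (codes n)).
  by rewrite (map_inj_uniq decode_inj) uniq_codes.
rewrite perm_sym; apply: uniq_perm => //; first exact: permutations_uniq.
apply: (uniq_min_size uc _ _).2.
  by move=> _ /mapP [c cn ->]; rewrite mem_permutations decode_perm.
by rewrite size_permutations ?iota_uniq // size_iota size_map size_codes.
Qed.

Lemma codes_size n c : c \in codes n -> size c = n.
Proof.
elim: n c => [|n IHn] [|x c] //; first by move/allpairsP => [? []].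
by rewrite mem_codes_cons => /andP [_ /IHn /= ->].
Qed.

(** [B] also receives the length of the suffix that starts at [x1]: it bounds the values available
    for a fifth letter. *)
Definition cstarts (B : nat -> nat -> nat -> nat -> nat -> bool) c : bool :=
  if c is [:: x1, x2, x3, x4 & r] then B (size r).+4 x1 x2 x3 x4 else false.

Fixpoint cavoids B (c : seq nat) : bool :=
  if c is _ :: r then ~~ cstarts B c && cavoids B r else true.

Definition ncav B n := count (cavoids B) (codes n).

(* The last letter [e] may range over all values: the letters of the word
   that are not to the right of the first four are these four themselves, and
   [occurs] excludes them. *)
Definition bad w n x1 x2 x3 x4 : bool :=
  has (fun e => occurs w [:: x1; bump x1 x2; bump x1 (bump x2 x3);
                             bump x1 (bump x2 (bump x3 x4)); e]) (iota 0 n).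

Lemma perm_occurs_seq (w u : seq nat) :
  perm_eq w (iota 1 (size w)) -> size u = size w ->
  perm_eq [seq nth 0 u (index k w) | k <- iota 1 (size w)] u.
Proof.
move=> wP su; have [uw _] := uniq_mem_pattern wP.
rewrite perm_sym in wP; apply: (perm_trans (perm_map _ wP)).
suff -> : [seq nth 0 u (index k w) | k <- w] = u by [].
apply: (@eq_from_nth _ 0) => [|i]; rewrite size_map // => iw.
by rewrite (nth_map 0) // index_uniq.
Qed.

Lemma occurs_uniq (w u : seq nat) :
  perm_eq w (iota 1 (size w)) -> size u = size w -> occurs w u -> uniq u.
Proof.
move=> wP su; rewrite -(perm_uniq (perm_occurs_seq wP su)).
exact: (sorted_uniq ltn_trans ltnn).
Qed.

Lemma occurs_ltn (w u : seq nat) i j :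
  perm_eq w (iota 1 (size w)) -> size u = size w -> occurs w u ->
  i < size w -> j < size w ->
  (nth 0 u i < nth 0 u j) = (nth 0 w i < nth 0 w j).
Proof.
move=> wP su occ; have [uw mw] := uniq_mem_pattern wP; move: occ; rewrite /occurs.
set l := [seq _ | _ <- _] => l_sorted.
have w_gt0 k : k < size w -> 0 < nth 0 w k < (size w).+1.
  by move=> kw; have := mem_nth 0 kw; rewrite mw mem_iota.
have lE k : k < size w -> nth 0 u k = nth 0 l (nth 0 w k).-1.
  move=> kw; have /andP [k0 kl] := w_gt0 k kw.
  rewrite (nth_map 0) ?size_iota; last by lia.
  by rewrite nth_iota ?add1n ?prednK // ?index_uniq //; lia.
move=> iw jw; rewrite !lE //; have := w_gt0 i iw; have := w_gt0 j jw.
have mono := sorted_ltn_nth ltn_trans 0 l_sorted.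
have sl : size l = size w by rewrite size_map size_iota.
move: (nth 0 w i) (nth 0 w j) => p q pP qP; case: (ltngtP p q) => [pq|qp|->].
- by rewrite mono // ?inE ?sl; lia.
- by apply/negbTE; rewrite -leqNgt ltnW // mono // ?inE ?sl; lia.
- by rewrite ltnn.
Qed.

Lemma avoids_decode w n c : perm_eq w (iota 1 5) -> c \in codes n ->
  avoids w (decode c) = cavoids (bad w) c.
Proof.
move=> wP; have sw : size w = 5 by rewrite (perm_size wP).
elim: n c => [|n IHn] [|x c] // xcn; have := xcn; rewrite mem_codes_cons => /andP [xn cn].
have -> : cavoids (bad w) (x :: c) = 
  ~~ cstarts (bad w) (x :: c) && cavoids (bad w) c by [].
have -> : avoids w (decode (x :: c)) =
          ~~ starts w (decode (x :: c)) && avoids w (map (bump x) (decode c)) by [].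
(* The tail of the decoded word is order-isomorphic to the word decoded from the tail of the
   code. *)
rewrite (@avoids_map w) ?IHn //; last first.
  move=> u u5 _; apply: occurs_mono; rewrite ?sw // => y z _ _.
  by rewrite /bump; lia.
congr (~~ _ && _).
case: c xcn {cn xn IHn} => [|x2 [|x3 [|x4 r]]] // xcn.
have pP := decode_perm xcn; have sn := codes_size xcn.
rewrite [cstarts _ _]/= [(size r).+4]sn /bad; move: pP.
rewrite [decode _]/=; set y2 := bump x x2; set y3 := bump x (bump x2 x3).
set y4 := bump x (bump x2 (bump x3 x4)); set t := map (bump x) _ => pP.
rewrite [starts _ _]/=.
(* An occurrence has distinct letters, so a fifth letter found anywhere in the range is none of the
   first four and lies to their right. *)
apply/hasP/hasP => -[e et occ]; exists e => //.
  by rewrite -(perm_mem pP) !inE et !orbT.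
have := occurs_uniq _ _ occ; rewrite sw => /(_ wP erefl).
rewrite -[[:: x; _; _; _; e]]/(rcons [:: x; y2; y3; y4] e) rcons_uniq => /andP [eN _].
move: et; rewrite -(perm_mem pP) -[_ :: _]/([:: x; y2; y3; y4] ++ t) mem_cat.
by rewrite (negbTE eN).
Qed.

Lemma nav_codes w n : perm_eq w (iota 1 5) -> nav w n = ncav (bad w) n.
Proof.
move=> wP; rewrite /nav (seq.permP (perm_codes n)) count_map.
by apply: eq_in_count => c cn /=; rewrite (avoids_decode wP cn).
Qed.

Lemma eq_ncav B B' n :
  (forall m x1 x2 x3 x4, x1 < m.+4 -> x2 < m.+3 -> x3 < m.+2 -> x4 < m.+1 ->
     B m.+4 x1 x2 x3 x4 = B' m.+4 x1 x2 x3 x4) ->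
  ncav B n = ncav B' n.
Proof.
move=> eqB; apply: eq_in_count => c; elim: n c => [|n IHn] [|x c] //.
rewrite mem_codes_cons => /andP [xn cn] /=; rewrite IHn //; congr (~~ _ && _).
case: c cn => [|x2 [|x3 [|x4 r]]] // cn.
have nE := codes_size cn; rewrite /= in nE; subst n.
by move: cn; rewrite !mem_codes_cons => /and4P [x2n x3n x4n _]; apply: eqB.
Qed.

Lemma count_codesS P n :
  count P (codes n.+1) = \sum_(0 <= x < n.+1) count (fun c => P (x :: c)) (codes n).
Proof.
rewrite /index_iota subn0.
have -> : codes n.+1 = [seq x :: r | x <- iota 0 n.+1, r <- codes n] by [].
elim: (iota 0 n.+1) => [|x s IHs]; first by rewrite big_nil.
by rewrite big_cons /= count_cat count_map IHs.
Qed.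

(** * Patterns whose occurrences share at most one letter *)

Definition ncav_from B n x := count (fun c => cavoids B (x :: c)) (codes n).

Lemma ncavS B n : ncav B n.+1 = \sum_(0 <= x < n.+1) ncav_from B n x.
Proof. exact: count_codesS. Qed.

(** The avoiding codes of length [n] are split according to whether [x] put in front starts an
    occurrence. *)
Lemma ncav_from_starts B n x :
  ncav_from B n x + count (fun c => cstarts B (x :: c) && cavoids B c) (codes n)
  = ncav B n.
Proof.
rewrite addnC /ncav -[RHS]size_filter -[RHS](count_predC (fun c => cstarts B (x :: c))).
by rewrite !count_filter; congr addn; apply: eq_count.
Qed.

Lemma ncav_from_short B n x : n < 3 -> ncav_from B n x = ncav B n.
Proof.
move=> n3; rewrite -(ncav_from_starts B n x) -[LHS]addn0; congr addn.
apply/esym/eqP; rewrite -leqn0 leqNgt -has_count; apply/hasPn => c /codes_size cn.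
by case: c cn => [|a [|b [|d r]]] //= rn; move: n3; rewrite -rn.
Qed.

(* Opposite steps at the two ends: then two distinct occurrences share at most
   one letter. *)
Definition overlap_at_most1 (B : nat -> nat -> nat -> nat -> nat -> bool) :=
  exists s t, forall n x1 x2 x3 x4, B n x1 x2 x3 x4 ->
    [/\ (x1 <= x2) = s, (x2 <= x3) = t & (x3 <= x4) = ~~ s].

(** When [x1], ..., [x4] is an occurrence, none starts at [x2] or [x3]. What remains is avoidance
    from [x4] on, so [x2] and [x3] enter only through the number of their choices. *)
Lemma ncav_from_overlap1 B n x1 : overlap_at_most1 B ->
  ncav_from B n.+3 x1 +
    \sum_(0 <= x4 < n.+1) (\sum_(0 <= x2 < n.+3) \sum_(0 <= x3 < n.+2)
       B n.+4 x1 x2 x3 x4) * ncav_from B n x4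
  = ncav B n.+3.
Proof.
move=> [s [t ov]]; rewrite -(ncav_from_starts B n.+3 x1); congr addn; apply/esym.
transitivity (\sum_(0 <= x2 < n.+3) \sum_(0 <= x3 < n.+2) \sum_(0 <= x4 < n.+1)
   B n.+4 x1 x2 x3 x4 * ncav_from B n x4); last first.
  under eq_bigr => x2 _ do rewrite exchange_big /=.
  rewrite exchange_big /=; apply: eq_bigr => x4 _.
  by rewrite big_distrl /=; apply: eq_bigr => x2 _; rewrite big_distrl.
rewrite count_codesS; apply: eq_bigr => x2 _.
rewrite count_codesS; apply: eq_bigr => x3 _.
rewrite count_codesS; apply: eq_bigr => x4 _.
case: (boolP (B n.+4 x1 x2 x3 x4)) => [Bx|/negbTE nBx]; last first.
  apply/eqP; rewrite mul0n -leqn0 leqNgt -has_count; apply/hasPn => u /codes_size un.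
  by rewrite /= un nBx.
rewrite mul1n; apply: eq_in_count => u /codes_size un; rewrite [LHS]/= un Bx /=.
have [sE tE nsE] := ov _ _ _ _ _ Bx.
suff : ~~ cstarts B [:: x2, x3, x4 & u] && ~~ cstarts B [:: x3, x4 & u].
  by move=> /andP [/= -> ->].
case: u {un} => [//|x5 u]; apply/andP; split.
  by apply/negP => /ov [tE' stE _]; move: nsE; rewrite stE -tE tE'; case: (s).
case: u => [//|x6 u]; apply/negP => /ov [sE' _ _]; move: nsE; rewrite sE'.
by case: (s).
Qed.

(** Strong induction on totals and refined counts together: the total is a sum of refined counts one
    step shorter, and the recurrence then yields the refined counts at the present length. *)
Lemma ncav_overlap1 B B' n :
  overlap_at_most1 B -> overlap_at_most1 B' ->
  (forall m x1 x4, x1 < m.+4 -> x4 < m.+1 ->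
     \sum_(0 <= x2 < m.+3) \sum_(0 <= x3 < m.+2) B m.+4 x1 x2 x3 x4 =
     \sum_(0 <= x2 < m.+3) \sum_(0 <= x3 < m.+2) B' m.+4 x1 x2 x3 x4) ->
  ncav B n = ncav B' n.
Proof.
move=> ovB ovB' eqB.
suff [] : ncav B n = ncav B' n /\
          (forall x, x < n.+1 -> ncav_from B n x = ncav_from B' n x) by [].
have [k] := ubnP n; elim: k n => // k IHk n nk.
have eqn : ncav B n = ncav B' n.
  case: n nk => // n nk; rewrite !ncavS !big_mkord; apply: eq_bigr => x _.
  by apply: (IHk n _).2.
split=> // x xn; have [n3|] := ltnP n 3; first by rewrite !ncav_from_short.
case: n nk eqn xn => [|[|[|n]]] // nk eqn xn _.
apply/eqP; rewrite -(eqn_add2r (\sum_(0 <= x4 < n.+1)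
  (\sum_(0 <= x2 < n.+3) \sum_(0 <= x3 < n.+2) B n.+4 x x2 x3 x4)
    * ncav_from B n x4)); apply/eqP.
rewrite ncav_from_overlap1 // eqn -(ncav_from_overlap1 n x ovB'); congr addn.
rewrite !big_mkord; apply: eq_bigr => x4 _; rewrite -eqB //; congr muln.
by apply/esym; apply: (IHk n _).2 => //; lia.
Qed.

Lemma eq_sum_bij (m n : nat) (P Q : nat -> nat -> bool) (f g : nat * nat -> nat * nat) :
  (forall b c, b < m -> c < n -> P b c ->
     [/\ (f (b, c)).1 < m, (f (b, c)).2 < n, Q (f (b, c)).1 (f (b, c)).2
       & g (f (b, c)) = (b, c)]) ->
  (forall b c, b < m -> c < n -> Q b c ->
     [/\ (g (b, c)).1 < m, (g (b, c)).2 < n, P (g (b, c)).1 (g (b, c)).2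
       & f (g (b, c)) = (b, c)]) ->
  \sum_(0 <= b < m) \sum_(0 <= c < n) P b c = \sum_(0 <= b < m) \sum_(0 <= c < n) Q b c.
Proof.
pose dom (R : nat -> nat -> bool) :=
  [seq p <- [seq (b, c) | b <- iota 0 m, c <- iota 0 n] | R p.1 p.2].
have sumE (R : nat -> nat -> bool) :
    \sum_(0 <= b < m) \sum_(0 <= c < n) R b c = size (dom R).
  rewrite size_filter /index_iota !subn0.
  elim: (iota 0 m) => [|b s IHs]; first by rewrite big_nil.
  rewrite big_cons /= count_cat count_map IHs; congr addn.
  by rewrite -[RHS]sum1_count [RHS]big_mkcond; apply: eq_bigr => c _ /=; case: (R b c).
have uniq_dom R : uniq (dom R).
  by rewrite filter_uniq // allpairs_uniq ?iota_uniq // => -[? ?] [? ?].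
have mem_dom (R : nat -> nat -> bool) p :
    (p \in dom R) = [&& p.1 < m, p.2 < n & R p.1 p.2].
  rewrite mem_filter andbC andbA; congr (_ && _).
  apply/allpairsP/andP => [[q [qm qn ->]]|[pm pn]].
    by move: qm qn; rewrite !mem_iota.
  by exists p; rewrite !mem_iota; split=> //; case: (p).
move=> fP gQ; rewrite !sumE -(size_map f (dom P)); apply: perm_size.
apply: uniq_perm => // [|p].
  rewrite map_inj_in_uniq // => -[b c] [b' c']; rewrite !mem_dom.
  case/and3P => bm cn /(fP _ _ bm cn) [_ _ _ gf].
  case/and3P => bm' cn' /(fP _ _ bm' cn') [_ _ _ gf'] /(congr1 g).
  by rewrite gf gf'.
apply/mapP/idP => [[[b c]]|].
  by rewrite !mem_dom => /and3P [bm cn /(fP _ _ bm cn) [? ? ? _]] ->; apply/and3P.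
case: p => b c; rewrite mem_dom => /and3P [bm cn /(gQ _ _ bm cn) [? ? ? fg]].
by exists (g (b, c)); rewrite ?mem_dom //; apply/and3P.
Qed.

(** Two consecutive letters rise exactly when their code entries rise weakly, so the steps of the
    code are those of [w]. *)
Lemma bad_overlap_at_most1 w : perm_eq w (iota 1 5) ->
  (nth 0 w 0 < nth 0 w 1) != (nth 0 w 2 < nth 0 w 3) -> overlap_at_most1 (bad w).
Proof.
move=> wP ne; have sw : size w = 5 by rewrite (perm_size wP).
exists (nth 0 w 0 < nth 0 w 1), (nth 0 w 1 < nth 0 w 2) => n x1 x2 x3 x4 /hasP [e _ occ].
rewrite -sw in wP.
have lt_w i j := @occurs_ltn w [:: x1; bump x1 x2; bump x1 (bump x2 x3);
  bump x1 (bump x2 (bump x3 x4)); e] i j wP (esym sw) occ.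
by move: ne; rewrite -!lt_w ?sw //= /bump; split; lia.
Qed.

(** This and the next three facts: moving a letter by one moves its code entry by one and keeps the
    entries of the others, provided that it does not collide with another letter. *)
Lemma bump_neqS x b : x != (bump x b).+1 -> bump x b.+1 = (bump x b).+1.
Proof. by rewrite /bump; lia. Qed.

Lemma bumpS_neq b c : b.+1 != bump b c -> bump b.+1 c = bump b c.
Proof. by rewrite /bump; lia. Qed.

Lemma bump_neq_pred x b : 0 < bump x b -> x != (bump x b).-1 ->
  0 < b /\ bump x b.-1 = (bump x b).-1.
Proof. by rewrite /bump; lia. Qed.

Lemma bump_pred_neq b c : 0 < b -> b.-1 != bump b c -> bump b.-1 c = bump b c.
Proof. by rewrite /bump; lia. Qed.

Lemma bump_eq x : {mono bump x : y z / y == z}.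
Proof. exact/inj_eq/can_inj/bumpK. Qed.

Section OverlapAtMost1.

Variables w w' : seq nat.
Hypotheses (wP : perm_eq w (iota 1 5)) (wP' : perm_eq w' (iota 1 5)).
Hypothesis step_w : (nth 0 w 0 < nth 0 w 1) != (nth 0 w 2 < nth 0 w 3).
Hypothesis step_w' : (nth 0 w' 0 < nth 0 w' 1) != (nth 0 w' 2 < nth 0 w' 3).

Let occurs_uniq5 v x1 x2 x3 x4 x5 : perm_eq v (iota 1 5) ->
  occurs v [:: x1; x2; x3; x4; x5] ->
  [/\ x1 != x2, x1 != x3, x2 != x3, x2 != x4 & x3 != x4].
Proof.
move=> vP occ; have : uniq [:: x1; x2; x3; x4; x5].
  by apply: occurs_uniq occ; rewrite (perm_size vP).
rewrite /= !inE !negb_or -!andbA.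
by case/and5P => -> -> _ _ /and5P [-> -> _ -> _].
Qed.

Lemma nav_swap23 n :
  (forall x1 x2 x3 x4 x5,
     occurs w' [:: x1; x3; x2; x4; x5] = occurs w [:: x1; x2; x3; x4; x5]) ->
  nav w n = nav w' n.
Proof.
move=> occE; rewrite !nav_codes //.
apply: ncav_overlap1 => [||m x1 x4 x1m x4m]; try exact: bad_overlap_at_most1.
(* [f] codes the same two letters in the opposite order and is its own inverse. The entry [x4]
   stays, since the set of letters before it is the same. *)
pose f p := (bump p.1 p.2, unbump (bump p.1 p.2) p.1).
apply: (@eq_sum_bij _ _ _ _ f f) => b c bm cm; rewrite /f /= => Bbc.
  have [bm' cm'] : bump b c < m.+3 /\ unbump (bump b c) b < m.+2.
    by rewrite /unbump /bump; lia.
  split=> //; last by rewrite /bump /unbump; congr pair; lia.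
  have -> : bad w' m.+4 x1 (bump b c) (unbump (bump b c) b) x4 = bad w m.+4 x1 b c x4.
    apply: eq_has => e; rewrite -occE; congr occurs.
    by rewrite /bump /unbump; congr [:: _; _; _; _; _]; lia.
  by [].
have [bm' cm'] : bump b c < m.+3 /\ unbump (bump b c) b < m.+2.
  by rewrite /unbump /bump; lia.
split=> //; last by rewrite /bump /unbump; congr pair; lia.
have -> : bad w m.+4 x1 (bump b c) (unbump (bump b c) b) x4 = bad w' m.+4 x1 b c x4.
  apply: eq_has => e; rewrite -occE; congr occurs.
  by rewrite /bump /unbump; congr [:: _; _; _; _; _]; lia.
by [].
Qed.

(** The hypotheses express that the second and fifth letters have neighbouring values. The second
    letter moves by one towards the fifth and the value it leaves becomes the new fifth letter; only
    one code entry changes. *)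
Lemma nav_exchange2 n :
  (forall x1 x2 x3 x4 x5, occurs w [:: x1; x2; x3; x4; x5] ->
     x2 < x5 /\ occurs w' [:: x1; x2.+1; x3; x4; x2]) ->
  (forall x1 x2 x3 x4 x5, occurs w' [:: x1; x2; x3; x4; x5] ->
     x5 < x2 /\ occurs w [:: x1; x2.-1; x3; x4; x2]) ->
  nav w n = nav w' n.
Proof.
move=> up down; rewrite !nav_codes //.
apply: ncav_overlap1 => [||m x1 x4 x1m x4m]; try exact: bad_overlap_at_most1.
apply: (@eq_sum_bij _ _ _ _ (fun p => (p.1.+1, p.2)) (fun p => (p.1.-1, p.2)));
  move=> b c bm cm /= /hasP [e]; rewrite mem_iota add0n => /= em.
  move=> /up [ltx occ]; have [n12 n13 n23 n24 n34] := occurs_uniq5 wP' occ.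
  have e1 := bump_neqS n12; rewrite -e1 !bump_eq in n23 n24 occ.
  (* The room for raising [b] comes from [e], a value of the word above the second letter. *)
  have bm' : b.+1 < m.+3 by clear occ; move: e1 ltx; rewrite /bump; lia.
  split=> //; apply/hasP; exists (bump x1 b); first by rewrite mem_iota; lia.
  by rewrite (bumpS_neq n23) (bumpS_neq n24).
move=> /down [ltx occ]; have [n12 n13 n23 n24 n34] := occurs_uniq5 wP occ.
have [b0 e1] := bump_neq_pred (leq_ltn_trans (leq0n e) ltx) n12.
rewrite -e1 !bump_eq in n23 n24 occ.
split=> //; [by lia| |by rewrite prednK].
apply/hasP; exists (bump x1 b); first by rewrite mem_iota /bump; lia.
by rewrite (bump_pred_neq b0 n23) (bump_pred_neq b0 n24).
Qed.

(** The same move for the third letter, whose code entry is decoded through two [bump]s, each to be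
    crossed without collision. *)
Lemma nav_exchange3 n :
  (forall x1 x2 x3 x4 x5, occurs w [:: x1; x2; x3; x4; x5] ->
     x3 < x5 /\ occurs w' [:: x1; x2; x3.+1; x4; x3]) ->
  (forall x1 x2 x3 x4 x5, occurs w' [:: x1; x2; x3; x4; x5] ->
     x5 < x3 /\ occurs w [:: x1; x2; x3.-1; x4; x3]) ->
  nav w n = nav w' n.
Proof.
move=> up down; rewrite !nav_codes //.
apply: ncav_overlap1 => [||m x1 x4 x1m x4m]; try exact: bad_overlap_at_most1.
apply: (@eq_sum_bij _ _ _ _ (fun p => (p.1, p.2.+1)) (fun p => (p.1, p.2.-1)));
  move=> b c bm cm /= /hasP [e]; rewrite mem_iota add0n => /= em.
  move=> /up [ltx occ]; have [n12 n13 n23 n24 n34] := occurs_uniq5 wP' occ.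
  have e1 := bump_neqS n13; rewrite -e1 !bump_eq in n23 n34 occ.
  have e2 := bump_neqS n23; rewrite -e2 !bump_eq in n34 occ.
  have cm' : c.+1 < m.+2 by clear occ; move: e2 e1 ltx; rewrite /bump; lia.
  split=> //; apply/hasP; exists (bump x1 (bump b c)); first by rewrite mem_iota; lia.
  by rewrite (bumpS_neq n34).
move=> /down [ltx occ]; have [n12 n13 n23 n24 n34] := occurs_uniq5 wP occ.
have [b0 e1] := bump_neq_pred (leq_ltn_trans (leq0n e) ltx) n13.
rewrite -e1 !bump_eq in n23 n34 occ.
have [c0 e2] := bump_neq_pred b0 n23; rewrite -e2 !bump_eq in n34 occ.
split=> //; [by lia| |by rewrite prednK].
apply/hasP; exists (bump x1 (bump b c)).
  by rewrite mem_iota /bump; clear - bm cm; lia.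
by rewrite (bump_pred_neq c0 n34).
Qed.

End OverlapAtMost1.

(** * The patterns 1235-4, 1245-3 and 1345-2 *)

Section IncreasingRuns.

Variable B : nat -> nat -> nat -> nat -> nat -> bool.
Hypothesis B_incr : forall n x1 x2 x3 x4, B n x1 x2 x3 x4 -> x1 <= x2 <= x3 /\ x3 <= x4.

Definition ext n pre := count (fun c => cavoids B (pre ++ c)) (codes n).

(* The number of continuations of a run that stops at [e]: the next entry, if
   there is one, is below [e]. *)
Definition ncav_below n e :=
  if n is m.+1 then \sum_(0 <= x < m.+1) (x < e) * ncav_from B m x else 1.

(** The complementary count, where the next entry continues the run. The empty continuation belongs
    to [ncav_below], hence the value 0. *)
Definition ncav_above n e :=
  if n is m.+1 then \sum_(0 <= x < m.+1) (e <= x) * ext m [:: e; x] else 0.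

Lemma cavoids_cons x c : cavoids B (x :: c) = ~~ cstarts B (x :: c) && cavoids B c.
Proof. by []. Qed.

Lemma cstarts_desc x1 x2 c : x2 < x1 -> cstarts B [:: x1, x2 & c] = false.
Proof.
by move=> lt21; case: c => [|x3 [|x4 c]] //=; apply/negP => /B_incr; lia.
Qed.

Lemma cstarts_desc2 x1 x2 x3 c : x3 < x2 -> cstarts B [:: x1, x2, x3 & c] = false.
Proof. by move=> lt32; case: c => [|x4 c] //=; apply/negP => /B_incr; lia. Qed.

Lemma cstarts_desc3 x1 x2 x3 x4 c : x4 < x3 ->
  cstarts B [:: x1, x2, x3, x4 & c] = false.
Proof. by move=> lt43; apply/negP => /B_incr; lia. Qed.

(** No occurrence crosses a descent, so an entry below [e] lets the prefix be forgotten; the prefix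
    itself is too short to contain an occurrence. *)
Lemma ext_split n pre e : size pre < 4 -> last e pre = e ->
  (if pre is [::] then false else true) ->
  ext n pre = ncav_below n e +
    (if n is m.+1 then \sum_(0 <= x < m.+1) (e <= x) * ext m (rcons pre x) else 0).
Proof.
move=> pre4 lastE pre0.
have avoids_desc x c : x < e -> cavoids B (pre ++ x :: c) = cavoids B (x :: c).
  move=> xe; case: pre pre4 lastE pre0 => [|y1 [|y2 [|y3 [|y4 r]]]] // _ lastE _;
    rewrite /= in lastE; rewrite lastE ?cat_cons cat0s !cavoids_cons.
  - by rewrite cstarts_desc.
  - by rewrite cstarts_desc2 // cstarts_desc.
  - by rewrite cstarts_desc3 // cstarts_desc2 // cstarts_desc.
case: n => [|n]; rewrite /ext.
  by rewrite /= cats0; case: pre pre4 {lastE pre0 avoids_desc} => [|y1 [|y2 [|y3 []]]].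
rewrite count_codesS -big_split /=; apply: eq_bigr => x _.
case: (ltnP x e) => [xe|ex].
  by rewrite mul1n addn0; apply: eq_count => c; rewrite avoids_desc.
by rewrite mul0n mul1n; apply: eq_count => c; rewrite cat_rcons.
Qed.

Lemma ncav_from_split n x : ncav_from B n x = ncav_below n x + ncav_above n x.
Proof. by rewrite -[LHS]/(ext n [:: x]) (@ext_split _ _ x). Qed.

(** Any weak rise would complete an occurrence, so the run must stop at [x3]. *)
Lemma ext_forbidden n x1 x2 x3 :
  (forall m x4, x3 <= x4 -> B m x1 x2 x3 x4) ->
  ext n [:: x1; x2; x3] = ncav_below n x3.
Proof.
move=> B4; rewrite (@ext_split _ _ x3) //; case: n => [|n]; rewrite ?addn0 //.
rewrite big1 ?addn0 // => x4 _; case: leqP => // le34; rewrite mul1n.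
by apply/eqP; rewrite -leqn0 leqNgt -has_count; apply/hasPn => c _ /=; rewrite B4.
Qed.

Lemma ncav_above_small n a : n <= a -> ncav_above n a = 0.
Proof.
case: n => //= n na; rewrite big_nat big1 // => x /andP [_ xn].
by rewrite (_ : a <= x = false) //; lia.
Qed.

(** Together with [ncav_from_split] this determines all counts, reaching back two lengths. The
    subtraction [c - a] is truncated: only [c > a] contributes. *)
Definition run_recurrence := forall n a,
  ncav_above n.+1 a = ncav_above n a + \sum_(0 <= b < n.+1) (a <= b) * ncav_below n b
    + (if n is m.+1 then \sum_(0 <= c < m.+1) (c - a) * ncav_below m c else 0).

End IncreasingRuns.

Lemma eq_run_recurrence (B B' : nat -> nat -> nat -> nat -> nat -> bool) n :
  (forall n x1 x2 x3 x4, B n x1 x2 x3 x4 -> x1 <= x2 <= x3 /\ x3 <= x4) ->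
  (forall n x1 x2 x3 x4, B' n x1 x2 x3 x4 -> x1 <= x2 <= x3 /\ x3 <= x4) ->
  run_recurrence B -> run_recurrence B' -> ncav B n = ncav B' n.
Proof.
move=> incr incr' rec rec'.
suff eq_above m : ncav_above B m =1 ncav_above B' m /\ ncav_below B m =1 ncav_below B' m.
  case: n => // n; rewrite !ncavS; apply: eq_bigr => x _.
  by have [eqa eqb] := eq_above n; rewrite !ncav_from_split // eqa eqb.
have [k] := ubnP m; elim: k m => // k IHk [|m] mk //.
have [eqa eqb] := IHk m mk; split=> e; last first.
  by apply: eq_bigr => x _; rewrite !ncav_from_split // eqa eqb.
rewrite rec rec' eqa; congr (_ + _ + _).
  by apply: eq_bigr => x _; rewrite eqb.
case: m mk {eqa eqb} => // m mk; have [|_ eqb] := IHk m; first by lia.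
by apply: eq_bigr => x _; rewrite eqb.
Qed.

Lemma sum_interval a c n f : c <= n ->
  \sum_(0 <= b < n) (a <= b) * ((b < c) * f) = (c - a) * f.
Proof.
move=> cn; under eq_bigr => b _ do rewrite mulnA; rewrite -big_distrl /=.
have small : \sum_(c <= b < n) (a <= b) * (b < c) = 0.
  rewrite big_nat big1 // => b /andP [cb _].
  by rewrite (_ : b < c = false) ?muln0 //; lia.
congr (_ * _); rewrite (big_cat_nat (n := c)) //= small addn0 big_nat.
rewrite (eq_bigr (fun b => a <= b : nat)); last by move=> b /andP [_ ->]; rewrite muln1.
rewrite -big_nat; elim: c {cn small} => [|c IHc]; first by rewrite big_nil.
by rewrite big_nat_recr //= IHc; lia.
Qed.

(** Rising letters mean weakly rising entries; the strict step marks the gap in which a letter on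
    the right must fit. The three cases are 1345-2, 1245-3 and 1235-4. *)
Definition incr1 (_ x1 x2 x3 x4 : nat) := [&& x1 < x2, x2 <= x3 & x3 <= x4].
Definition incr2 (_ x1 x2 x3 x4 : nat) := [&& x1 <= x2, x2 < x3 & x3 <= x4].
Definition incr3 (_ x1 x2 x3 x4 : nat) := [&& x1 <= x2, x2 <= x3 & x3 < x4].

Lemma incr1_incr n x1 x2 x3 x4 : incr1 n x1 x2 x3 x4 -> x1 <= x2 <= x3 /\ x3 <= x4.
Proof. by rewrite /incr1; lia. Qed.
Lemma incr2_incr n x1 x2 x3 x4 : incr2 n x1 x2 x3 x4 -> x1 <= x2 <= x3 /\ x3 <= x4.
Proof. by rewrite /incr2; lia. Qed.
Lemma incr3_incr n x1 x2 x3 x4 : incr3 n x1 x2 x3 x4 -> x1 <= x2 <= x3 /\ x3 <= x4.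
Proof. by rewrite /incr3; lia. Qed.

Lemma run_recurrence1 : run_recurrence incr1.
Proof.
move=> n a.
have ext_eq : ext incr1 n [:: a; a] = ncav_from incr1 n a.
  apply: eq_count => c /=; suff -> : ~~ cstarts incr1 [:: a, a & c] by [].
  by case: c => [|b [|d c]] //=; rewrite /incr1 ltnn.
have ext_lt x : a < x -> ext incr1 n [:: a; x] = ncav_below incr1 n x +
    (if n is m.+1 then \sum_(0 <= c < m.+1) (x <= c) * ncav_below incr1 m c else 0).
  move=> ax; rewrite (ext_split incr1_incr _ (e := x)) //; congr addn.
  case: n {ext_eq} => // m; apply: eq_bigr => y _; case: leqP => // xy.
  by rewrite !mul1n ext_forbidden //; [exact: incr1_incr|rewrite /incr1 ax xy].
rewrite /=; case: (leqP n.+1 a) => na.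
  rewrite ncav_above_small; last by lia.
  rewrite ![\sum_(0 <= _ < n.+1) _]big_nat !big1 => [|x|x]; rewrite ?add0n; last first.
  - by move=> /andP [_ xn]; rewrite (_ : a <= x = false) //; lia.
  - by move=> /andP [_ xn]; rewrite (_ : a <= x = false) //; lia.
  case: n na {ext_eq ext_lt} => // n na; rewrite big_nat big1 // => c /andP [_ cn].
  by rewrite (_ : c - a = 0) //; lia.
transitivity (\sum_(0 <= x < n.+1) ((a == x) * ncav_above incr1 n a
   + (a <= x) * ncav_below incr1 n x + (a < x) * (if n is m.+1 then
     \sum_(0 <= c < m.+1) (x <= c) * ncav_below incr1 m c else 0))).
  apply: eq_bigr => x _; case: (ltngtP a x) => [ax|//|<-].
    by rewrite ext_lt // !mul1n.
  by rewrite !mul1n ext_eq ncav_from_split 1?addnC ?addn0 //; exact: incr1_incr.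
rewrite !big_split /=; congr (_ + _ + _).
  rewrite -big_distrl /= -[RHS]mul1n; congr muln.
  rewrite (bigD1_seq a) ?mem_index_iota ?iota_uniq //= eqxx big1 // => x.
  by rewrite eq_sym => /negbTE ->.
case: n na {ext_eq ext_lt} => [|m] na; first by rewrite big1 // => x _; rewrite muln0.
under eq_bigr => x _ do rewrite big_distrr /=.
rewrite exchange_big /= big_nat [RHS]big_nat; apply: eq_bigr => c /andP [_ cm].
(* Writing a positive [x] as [b.+1] turns [a < x <= c] into [a <= b < c]. *)
by rewrite -(@sum_interval a c m.+1 _ (ltnW cm)) big_nat_recl.
Qed.

(** After [a <= b], a third entry above [b] must end the run, while a third entry equal to [b] lets
    [a] be dropped; the pair [b], [b] has as many continuations as [a], [b]. *)
Lemma run_recurrence2 : run_recurrence incr2.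
Proof.
have extE a b n : a <= b -> ext incr2 n [:: a; b] = ncav_below incr2 n b +
    (if n is m.+1 then (b <= m) * ext incr2 m [:: b; b]
      + \sum_(0 <= c < m.+1) (b < c) * ncav_below incr2 m c else 0).
  move=> ab; rewrite (ext_split incr2_incr _ (e := b)) //; congr addn.
  case: n => // m.
  transitivity (\sum_(0 <= c < m.+1) ((b == c) * ext incr2 m [:: b; b]
     + (b < c) * ncav_below incr2 m c)).
    apply: eq_bigr => c _; case: (ltngtP b c) => [bc|//|<-]; rewrite !mul1n.
      by rewrite ext_forbidden //; [exact: incr2_incr|rewrite /incr2 ab bc].
    rewrite addn0; apply: eq_count => u /=.
    suff -> : ~~ cstarts incr2 [:: a, b, b & u] by [].
    by case: u => [|d u] //=; rewrite /incr2 ltnn andbF.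
  rewrite big_split /= -big_distrl /=; congr (_ * _ + _).
  case: (leqP b m) => bm; last first.
    rewrite big_nat big1 // => x /andP [_ xm].
    by rewrite (_ : b == x = false) //; lia.
  rewrite (bigD1_seq b) ?mem_index_iota ?iota_uniq //= eqxx big1 // => x.
  by rewrite eq_sym => /negbTE ->.
have ext_same a b n : a <= b -> ext incr2 n [:: a; b] = ext incr2 n [:: b; b].
  by move=> ab; rewrite !extE.
move=> n a; rewrite /=.
transitivity (\sum_(0 <= b < n.+1) (a <= b) * (ncav_below incr2 n b +
    (if n is m.+1 then (b <= m) * ext incr2 m [:: a; b]
      + \sum_(0 <= c < m.+1) (b < c) * ncav_below incr2 m c else 0))).
  apply: eq_bigr => b _; case: leqP => // ab; rewrite !mul1n extE //.
  by case: n => // m; rewrite (ext_same a b).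
under eq_bigr => b _ do rewrite mulnDr.
rewrite big_split /=; case: n => [|m].
  by rewrite addn0 add0n [X in _ + X]big1 ?addn0 // => b _; rewrite muln0.
rewrite addnC addnAC; congr addn.
under eq_bigr => b _ do rewrite mulnDr.
rewrite big_split /=; congr addn.
  (* The top index [m.+1] fails [b <= m] and contributes nothing. *)
  rewrite big_nat_recr //= ltnn mul0n muln0 addn0.
  rewrite big_nat [RHS]big_nat; apply: eq_bigr => b /andP [_].
  by rewrite ltnS => ->; rewrite mul1n.
under eq_bigr => b _ do rewrite big_distrr /=.
rewrite exchange_big /= big_nat [RHS]big_nat; apply: eq_bigr => c /andP [_ cm].
by apply: sum_interval; lia.
Qed.

(** From [a <= b <= c] on, a run can only stay at [c] before it stops, so the count depends on [c]
    alone. Expanding it once and writing [c.+1 - a] as [(a <= c) + (c - a)] recovers the count for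
    the previous length. *)
Lemma run_recurrence3 : run_recurrence incr3.
Proof.
have ext3E a b c n : a <= b <= c -> ext incr3 n [:: a; b; c] = ncav_below incr3 n c +
    (if n is m.+1 then (c <= m) * ext incr3 m [:: b; c; c] else 0).
  move=> /andP [ab bc]; rewrite (ext_split incr3_incr _ (e := c)) //; congr addn.
  case: n => // m.
  transitivity (\sum_(0 <= d < m.+1) (c == d) * ext incr3 m [:: b; c; c]).
    apply: eq_bigr => d _; case: (ltngtP c d) => [cd|//|<-]; rewrite !mul1n ?mul0n.
      apply/eqP; rewrite -leqn0 leqNgt -has_count; apply/hasPn => u _ /=.
      by rewrite /incr3 ab bc cd.
    by apply: eq_count => u /=; rewrite /incr3 ltnn !andbF.
  rewrite -big_distrl /=; congr (_ * _).
  case: (leqP c m) => cm; last first.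
    rewrite big_nat big1 // => x /andP [_ xm].
    by rewrite (_ : c == x = false) //; lia.
  rewrite (bigD1_seq c) ?mem_index_iota ?iota_uniq //= eqxx big1 // => x.
  by rewrite eq_sym => /negbTE ->.
have ext3_same a b c n : a <= b <= c ->
    ext incr3 n [:: a; b; c] = ext incr3 n [:: c; c; c].
  elim: n a b c => [|n IHn] a b c abc; rewrite ext3E // [RHS]ext3E ?leqnn //.
  by congr (_ + _ * _); apply: IHn; lia.
have aboveE n a : ncav_above incr3 n.+1 a =
    \sum_(0 <= b < n.+1) (a <= b) * ncav_below incr3 n b +
    (if n is m.+1
     then \sum_(0 <= c < m.+1) (c.+1 - a) * ext incr3 m [:: c; c; c] else 0).
  rewrite /=; transitivity (\sum_(0 <= b < n.+1) (a <= b) * (ncav_below incr3 n b +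
      (if n is m.+1
       then \sum_(0 <= c < m.+1) (b <= c) * ext incr3 m [:: c; c; c] else 0))).
    apply: eq_bigr => b _; case: leqP => // ab; rewrite !mul1n.
    rewrite (ext_split incr3_incr _ (e := b)) //; congr addn; case: n => // m.
    by apply: eq_bigr => c _; case: leqP => // bc; rewrite ext3_same // ab.
  under eq_bigr => b _ do rewrite mulnDr.
  rewrite big_split /=; congr addn; case: n => [|m].
    by rewrite big1 // => b _; rewrite muln0.
  under eq_bigr => b _ do rewrite big_distrr /=.
  rewrite exchange_big /= big_nat [RHS]big_nat; apply: eq_bigr => c /andP [_ cm].
  by rewrite -(@sum_interval a c.+1 m.+2) //; lia.
move=> [|m] a; first by rewrite aboveE !addn0.
rewrite aboveE [RHS]addnAC [in RHS]addnC; congr addn.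
transitivity (\sum_(0 <= c < m.+1) ((a <= c) * ncav_below incr3 m c
  + (c - a) * ncav_below incr3 m c + (c.+1 - a) * (if m is k.+1 then
     (c <= k) * ext incr3 k [:: c; c; c] else 0))).
  apply: eq_bigr => c _; rewrite ext3E ?leqnn // mulnDr -mulnDl; congr (_ * _ + _).
  by lia.
rewrite aboveE !big_split /= addnAC; congr (_ + _ + _).
case: m => [|k]; first by rewrite big1 // => c _; rewrite muln0.
rewrite big_nat_recr //= ltnn mul0n muln0 addn0.
rewrite big_nat [RHS]big_nat; apply: eq_bigr => c /andP [_].
by rewrite ltnS => ->; rewrite mul1n.
Qed.

Lemma nav_incr1 n : nav [:: 1; 3; 4; 5; 2] n = ncav incr1 n.
Proof.
rewrite nav_codes //; apply: eq_ncav => m x1 x2 x3 x4 m1 m2 m3 m4.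
rewrite /bad /incr1 /occurs /bump; apply/hasP/idP => [[e _ /=]|incr]; first by lia.
by exists x1.+1; [rewrite mem_iota; lia|rewrite /=; lia].
Qed.

Lemma nav_incr2 n : nav [:: 1; 2; 4; 5; 3] n = ncav incr2 n.
Proof.
rewrite nav_codes //; apply: eq_ncav => m x1 x2 x3 x4 m1 m2 m3 m4.
rewrite /bad /incr2 /occurs /bump; apply/hasP/idP => [[e _ /=]|incr]; first by lia.
(* The fifth letter is put just above the lower end of its gap: here the second letter, which is
   [x2.+1]. *)
by exists x2.+2; [rewrite mem_iota; lia|rewrite /=; lia].
Qed.

Lemma nav_incr3 n : nav [:: 1; 2; 3; 5; 4] n = ncav incr3 n.
Proof.
rewrite nav_codes //; apply: eq_ncav => m x1 x2 x3 x4 m1 m2 m3 m4.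
rewrite /bad /incr3 /occurs /bump; apply/hasP/idP => [[e _ /=]|incr]; first by lia.
by exists x3.+3; [rewrite mem_iota; lia|rewrite /=; lia].
Qed.

Lemma nav12354 n : nav [:: 1; 2; 3; 5; 4] n = nav [:: 1; 2; 4; 5; 3] n.
Proof.
rewrite nav_incr3 nav_incr2; apply: eq_run_recurrence.
- exact: incr3_incr.
- exact: incr2_incr.
- exact: run_recurrence3.
- exact: run_recurrence2.
Qed.

Lemma nav12453 n : nav [:: 1; 2; 4; 5; 3] n = nav [:: 1; 3; 4; 5; 2] n.
Proof.
rewrite nav_incr2 nav_incr1; apply: eq_run_recurrence.
- exact: incr2_incr.
- exact: incr1_incr.
- exact: run_recurrence2.
- exact: run_recurrence1.
Qed.

(** * The patterns 2153-4 and 3154-2 *)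

Section SplitPattern.

Variables (P : nat -> nat -> bool) (Q : nat -> nat -> nat -> bool).

(** [Q] does not see [x2], so the number of ways to go on after an occurrence depends on [x1] but
    not on [x2]. *)
Definition split_bad (_ x1 x2 x3 x4 : nat) := P x1 x2 && Q x1 x3 x4.

Hypothesis split_badP : forall n x1 x2 x3 x4,
  split_bad n x1 x2 x3 x4 -> x2 < x1 /\ x2 < x3.

Definition ncav_from2 n x1 x2 :=
  count (fun c => cavoids split_bad [:: x1, x2 & c]) (codes n).

(** The ways to complete an occurrence from [x1] and go on. Since [x3], [x4] may be the first two
    letters of another occurrence, both are kept in [ncav_from2]. *)
Definition nlink n x1 :=
  \sum_(0 <= x3 < n.+2) \sum_(0 <= x4 < n.+1) Q x1 x3 x4 * ncav_from2 n x3 x4.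

Lemma ncav_from2_split n x1 x2 :
  ncav_from2 n x1 x2 +
    count (fun c => cstarts split_bad [:: x1, x2 & c] && cavoids split_bad (x2 :: c))
      (codes n) = ncav_from split_bad n x2.
Proof.
rewrite addnC /ncav_from -[RHS]size_filter.
rewrite -[RHS](count_predC (fun c => cstarts split_bad [:: x1, x2 & c])).
by rewrite !count_filter; congr addn; apply: eq_count.
Qed.

Lemma ncav_from2_short n x1 x2 : n < 2 -> ncav_from2 n x1 x2 = ncav_from split_bad n x2.
Proof.
move=> n2; rewrite -(ncav_from2_split n x1 x2) -[LHS]addn0; congr addn.
apply/esym/eqP; rewrite -leqn0 leqNgt -has_count; apply/hasPn => c /codes_size cn.
by case: c cn => [|a [|b r]] //= rn; move: n2; rewrite -rn.
Qed.

(** An occurrence at [x1] has [x2 < x3], whereas one at [x2] would need [x3 < x2]; so only avoidance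
    from [x3] on remains to be imposed. *)
Lemma ncav_from2_rec n x1 x2 :
  ncav_from2 n.+2 x1 x2 + P x1 x2 * nlink n x1 = ncav_from split_bad n.+2 x2.
Proof.
rewrite -(ncav_from2_split n.+2 x1 x2); congr addn; apply/esym.
rewrite count_codesS /nlink big_distrr; apply: eq_bigr => x3 _ /=.
rewrite count_codesS big_distrr; apply: eq_bigr => x4 _ /=.
rewrite mulnA mulnb.
case: (boolP (P x1 x2 && Q x1 x3 x4)) => [Bx|/negbTE nBx]; last first.
  apply/eqP; rewrite mul0n -leqn0 leqNgt -has_count; apply/hasPn => u _.
  by rewrite /= /split_bad nBx.
rewrite mul1n; apply: eq_count => u.
have [_ lt23] := split_badP (n := 0) Bx.
have starts_x2 : cstarts split_bad [:: x2, x3, x4 & u] = false.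
  case: u => [//|x5 u]; apply/negP => Bu.
  have [lt32 _] := split_badP (n := (size u).+4) Bu;
  by move: lt23; rewrite ltnNge ltnW.
rewrite -[LHS]/(cstarts split_bad [:: x1, x2, x3, x4 & u] &&
  cavoids split_bad [:: x2, x3, x4 & u]).
have -> : cstarts split_bad [:: x1, x2, x3, x4 & u] = P x1 x2 && Q x1 x3 x4 by [].
rewrite Bx.
have -> : cavoids split_bad [:: x2, x3, x4 & u] =
  ~~ cstarts split_bad [:: x2, x3, x4 & u] && cavoids split_bad [:: x3, x4 & u] by [].
by rewrite starts_x2.
Qed.

Lemma ncav_fromS n x1 :
  ncav_from split_bad n.+1 x1 = \sum_(0 <= x2 < n.+1) ncav_from2 n x1 x2.
Proof. exact: count_codesS. Qed.

Lemma ncav_from_rec n x1 :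
  ncav_from split_bad n.+3 x1 + (\sum_(0 <= x2 < n.+3) P x1 x2) * nlink n x1
  = ncav split_bad n.+3.
Proof.
rewrite ncav_fromS big_distrl -big_split ncavS; apply: eq_bigr => x2 _ /=.
exact: ncav_from2_rec.
Qed.

Lemma nlink_short n x1 : n < 2 ->
  nlink n x1 = \sum_(0 <= x3 < n.+2) \sum_(0 <= x4 < n.+1)
    Q x1 x3 x4 * ncav_from split_bad n x4.
Proof.
move=> n2; apply: eq_bigr => x3 _; apply: eq_bigr => x4 _.
by rewrite ncav_from2_short.
Qed.

Lemma nlink_rec n x1 :
  nlink n.+2 x1 + \sum_(0 <= x3 < n.+4) \sum_(0 <= x4 < n.+3)
      Q x1 x3 x4 * P x3 x4 * nlink n x3
  = \sum_(0 <= x3 < n.+4) \sum_(0 <= x4 < n.+3) Q x1 x3 x4 * ncav_from split_bad n.+2 x4.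
Proof.
rewrite /nlink -big_split; apply: eq_bigr => x3 _ /=.
rewrite -big_split; apply: eq_bigr => x4 _ /=.
by rewrite -mulnA -mulnDr ncav_from2_rec.
Qed.

End SplitPattern.

(* In both patterns 3154-2 and 2153-4, [x1 > x2] are followed by [x3 > x4], both
   letters being larger; the gap in which the last letter lies is between the
   first two letters for the former, between the next two for the latter. *)
Definition skip2 x1 x2 := x2.+1 < x1.
Definition skip_link x1 x3 x4 := (x1 <= x4.+1) && (x4 < x3).
Definition desc2 (x1 x2 : nat) := x2 < x1.
Definition link_skip x1 x3 x4 := (x1 <= x4.+1) && (x4.+1 < x3).

Notation bad31542 := (split_bad skip2 skip_link).
Notation bad21534 := (split_bad desc2 link_skip).

Lemma split_bad1P n x1 x2 x3 x4 : bad31542 n x1 x2 x3 x4 -> x2 < x1 /\ x2 < x3.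
Proof. by rewrite /split_bad /skip2 /skip_link; lia. Qed.

Lemma split_bad3P n x1 x2 x3 x4 : bad21534 n x1 x2 x3 x4 -> x2 < x1 /\ x2 < x3.
Proof. by rewrite /split_bad /desc2 /link_skip; lia. Qed.

Lemma nlink3_eq0 n x1 : n.+1 < x1 -> nlink desc2 link_skip n x1 = 0.
Proof.
move=> nx; rewrite /nlink big1 // => x3 _; rewrite big_nat big1 // => x4 /andP [_ x4n].
by rewrite (_ : link_skip x1 x3 x4 = false) // /link_skip; lia.
Qed.

Lemma sum_ltn n a : \sum_(0 <= x < n) (x < a) = minn n a.
Proof.
elim: n => [|n IHn]; first by rewrite big_nil min0n.
by rewrite big_nat_recr //= IHn; lia.
Qed.

(** The smallest letter cannot start 3154-2 and, in the next lemma, the largest cannot start 2153-4: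
    these two first letters are matched by the cyclic shift. *)
Lemma ncav_from1_0 n : ncav_from bad31542 n 0 = ncav bad31542 n.
Proof.
have [n3|] := ltnP n 3; first by rewrite ncav_from_short.
case: n => [|[|[|n]]] // _; rewrite -(ncav_from_rec split_bad1P n 0) big1 ?addn0 //.
Qed.

Lemma ncav_from3_n n : ncav_from bad21534 n n = ncav bad21534 n.
Proof.
have [n3|] := ltnP n 3; first by rewrite ncav_from_short.
case: n => [|[|[|n]]] // _; rewrite -(ncav_from_rec split_bad3P n n.+3).
by rewrite nlink3_eq0 ?muln0 ?addn0 //; lia.
Qed.

Lemma ncav_from13 n x : x < n -> ncav bad31542 n = ncav bad21534 n ->
  (forall m c, m < n -> 0 < c ->
     nlink skip2 skip_link m c.+1 = nlink desc2 link_skip m c) ->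
  ncav_from bad31542 n x.+1 = ncav_from bad21534 n x.
Proof.
move=> xn eqS eqK; have [n3|] := ltnP n 3; first by rewrite !ncav_from_short.
case: n xn eqS eqK => [|[|[|n]]] // xn eqS eqK _.
have := ncav_from_rec split_bad1P n x.+1; have := ncav_from_rec split_bad3P n x.
rewrite eqS => <-; rewrite /skip2 /desc2 !sum_ltn (minn_idPr (ltnW xn)).
(* For [x = 0] both numbers of choices vanish, so equality of the links is wanted at positive
   arguments only. *)
case: x xn => [|x] xn; first by rewrite !mul0n !addn0.
by rewrite eqK //; last lia; move/addIn.
Qed.

(** Shifting [x4] by one matches the main sums of the two recurrences; shifting both [x3] and [x4]
    matches the correction sums. The boundary terms vanish, at [x4 = 0] because [c] is positive. *)
Lemma nlink13 n c : 0 < c ->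
  (forall x, x < n -> ncav_from bad31542 n x.+1 = ncav_from bad21534 n x) ->
  (forall m d, m < n -> 0 < d ->
     nlink skip2 skip_link m d.+1 = nlink desc2 link_skip m d) ->
  nlink skip2 skip_link n c.+1 = nlink desc2 link_skip n c.
Proof.
move=> c0 eqF eqK.
have eqQF :
    \sum_(0 <= x3 < n.+2) \sum_(0 <= x4 < n.+1)
      skip_link c.+1 x3 x4 * ncav_from bad31542 n x4 =
    \sum_(0 <= x3 < n.+2) \sum_(0 <= x4 < n.+1)
      link_skip c x3 x4 * ncav_from bad21534 n x4.
  rewrite big_nat [RHS]big_nat; apply: eq_bigr => x3 /andP [_ x3n].
  rewrite big_nat_recl // [RHS]big_nat_recr //=.
  rewrite (_ : skip_link c.+1 x3 0 = false); last by rewrite /skip_link; lia.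
  rewrite (_ : link_skip c x3 n = false); last by rewrite /link_skip; lia.
  rewrite !mul0n add0n addn0 big_nat [RHS]big_nat.
  by apply: eq_bigr => x /andP [_ xn]; rewrite eqF.
have [n2|] := ltnP n 2; first by rewrite !nlink_short //; apply: split_bad1P.
case: n eqF eqK eqQF => [|[|n]] // eqF eqK eqQF _.
have := nlink_rec split_bad1P n c.+1; have := nlink_rec split_bad3P n c.
rewrite eqQF => <-; rewrite [X in _ + X = _](_ : _ = \sum_(0 <= x3 < n.+4)
  \sum_(0 <= x4 < n.+3) link_skip c x3 x4 * desc2 x3 x4 * nlink desc2 link_skip n x3).
  by move/addIn.
rewrite big_nat_recl // [RHS]big_nat_recr //= [X in X + _]big1 ?add0n; last first.
  by move=> x4 _; rewrite /skip_link ltn0 andbF.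
rewrite nlink3_eq0; last by lia.
rewrite [X in _ + X]big1 ?addn0 => [|x4 _]; last by rewrite muln0.
rewrite big_nat [RHS]big_nat; apply: eq_bigr => x3 /andP [_ x3n].
rewrite big_nat_recl // [RHS]big_nat_recr //=.
rewrite (_ : skip_link c.+1 x3.+1 0 = false); last by rewrite /skip_link; lia.
rewrite (_ : link_skip c x3 n.+2 = false); last by rewrite /link_skip; lia.
rewrite !mul0n add0n addn0; apply: eq_bigr => x4 _.
rewrite (_ : skip_link c.+1 x3.+1 x4.+1 * skip2 x3.+1 x4.+1 =
             link_skip c x3 x4 * desc2 x3 x4); last first.
  by rewrite /skip_link /skip2 /link_skip /desc2; lia.
case: (posnP x3) => [->|x3_gt0]; first by rewrite /desc2 ltn0 !muln0.
by rewrite eqK //; lia.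
Qed.

Lemma ncav13 n : ncav bad31542 n = ncav bad21534 n.
Proof.
suff [] : ncav bad31542 n = ncav bad21534 n /\
    (forall c, 0 < c -> nlink skip2 skip_link n c.+1 = nlink desc2 link_skip n c) by [].
have [k] := ubnP n; elim: k n => // k IHk n nk.
have eqF m x : m < n -> x < m -> ncav_from bad31542 m x.+1 = ncav_from bad21534 m x.
  move=> mn xm; apply: ncav_from13 => // [|j c jm c0]; first by apply: (IHk m _).1; lia.
  by apply: (IHk j _).2 => //; lia.
have eqn : ncav bad31542 n = ncav bad21534 n.
  (* The lowest first letter on the left is set against the highest on the right; the others are
     matched by the shift. *)
  case: n nk eqF => // n nk eqF; rewrite !ncavS big_nat_recl // [RHS]big_nat_recr //=.
  rewrite addnC ncav_from1_0 ncav_from3_n (IHk n _).1 //; congr addn.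
  by rewrite big_nat [RHS]big_nat; apply: eq_bigr => x /andP [_ xn]; apply: eqF.
have eqK m c : m < n -> 0 < c ->
     nlink skip2 skip_link m c.+1 = nlink desc2 link_skip m c.
  by move=> mn c0; apply: (IHk m _).2 => //; lia.
split=> // c c0; apply: nlink13 => // x xn; exact: ncav_from13.
Qed.

Lemma nav21534 n : nav [:: 2; 1; 5; 3; 4] n = nav [:: 3; 1; 5; 4; 2] n.
Proof.
transitivity (ncav bad21534 n).
  rewrite nav_codes //; apply: eq_ncav => m x1 x2 x3 x4 m1 m2 m3 m4.
  rewrite /bad /split_bad /desc2 /link_skip /occurs /bump.
  apply/hasP/idP => [[e _ /=]|lnk]; first by lia.
  (* The fourth letter is above the first two and below the third, so it equals [x4.+2], and the
     next value is taken. *)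
  by exists (x4.+3); [rewrite mem_iota; lia|rewrite /=; lia].
rewrite -ncav13 nav_codes //; apply: eq_ncav => m x1 x2 x3 x4 m1 m2 m3 m4.
rewrite /bad /split_bad /skip2 /skip_link /occurs /bump.
apply/idP/hasP => [lnk|[e _ /=]]; last by lia.
by exists (x2.+1); [rewrite mem_iota; lia|rewrite /=; lia].
Qed.

(** * Tabulation *)

Lemma nat_of_addN (a b : N) : (a + b)%num = a + b :> nat.
Proof. by case: a b => [|p] [|q] //=; rewrite ?addn0 ?nat_of_add_pos. Qed.

Section Table.

Variable B : nat -> nat -> nat -> nat -> nat -> bool.

Definition ncav_from3 n x1 x2 x3 :=
  count (fun c => cavoids B [:: x1, x2, x3 & c]) (codes n).

Definition tabulate n (f : nat -> nat -> nat -> N) : seq (seq (seq N)) :=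
  [seq [seq [seq f x1 x2 x3 | x3 <- iota 0 n.+1] | x2 <- iota 0 n.+2]
     | x1 <- iota 0 n.+3].

Definition lookup (t : seq (seq (seq N))) x1 x2 x3 : N :=
  nth 0%num (nth [::] (nth [::] t x1) x2) x3.

Definition table_entry n t x1 x2 x3 : N :=
  foldr (fun x4 acc =>
      if B n.+4 x1 x2 x3 x4 then acc else (lookup t x2 x3 x4 + acc)%num)
    0%num (iota 0 n.+1).

(** A sliding window: counts are indexed by the first three entries of a code of length [n.+3], so a
    new first entry only calls for the triples that follow it. *)
Fixpoint table n : seq (seq (seq N)) :=
  if n is m.+1 then let t := table m in tabulate n (table_entry m t)
  else tabulate 0 (fun _ _ _ => 1%num).

Definition ncavN n : N :=
  foldr N.add 0%num (flatten (flatten (table n))).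

Lemma lookup_tabulate n f x1 x2 x3 : x1 < n.+3 -> x2 < n.+2 -> x3 < n.+1 ->
  lookup (tabulate n f) x1 x2 x3 = f x1 x2 x3.
Proof.
move=> x1n x2n x3n; rewrite /lookup /tabulate.
by rewrite !(nth_map 0) ?size_iota // !nth_iota.
Qed.

Lemma tableE n x1 x2 x3 : x1 < n.+3 -> x2 < n.+2 -> x3 < n.+1 ->
  nat_of_bin (lookup (table n) x1 x2 x3) = ncav_from3 n x1 x2 x3.
Proof.
elim: n x1 x2 x3 => [|n IHn] x1 x2 x3 x1n x2n x3n.
  by rewrite [table _]/= lookup_tabulate.
rewrite [table _]/= lookup_tabulate // /table_entry.
rewrite /ncav_from3 count_codesS /index_iota subn0.
have : {subset iota 0 n.+1 <= gtn n.+1} by move=> x; rewrite mem_iota.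
elim: (iota 0 n.+1) => [|x4 s IHs] sub; first by rewrite big_nil.
rewrite big_cons -IHs => [|x xs]; last by rewrite sub // inE xs orbT.
rewrite [foldr _ _ (_ :: _)]/=; case: ifP => Bx.
  suff -> : count (fun c => cavoids B [:: x1, x2, x3, x4 & c]) (codes n) = 0 by [].
  apply/eqP; rewrite -leqn0 leqNgt -has_count; apply/hasPn => c /codes_size sc.
  by rewrite /= sc Bx.
rewrite nat_of_addN IHn //; last by have := sub x4; rewrite inE eqxx => /(_ isT).
suff -> : count (fun c => cavoids B [:: x1, x2, x3, x4 & c]) (codes n)
          = ncav_from3 n x2 x3 x4 by [].
apply: eq_in_count => c /codes_size sc.
have -> : cavoids B [:: x1, x2, x3, x4 & c] =
  ~~ B (size c).+4 x1 x2 x3 x4 && cavoids B [:: x2, x3, x4 & c] by [].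
by rewrite sc Bx.
Qed.

Lemma ncavNE n : nat_of_bin (ncavN n) = ncav B n.+3.
Proof.
have sumE (s : seq N) : nat_of_bin (foldr N.add 0%num s) = \sum_(x <- s) nat_of_bin x.
  by elim: s => [|x s IHs]; rewrite ?big_nil // big_cons -IHs -nat_of_addN.
have [f tE] : exists f, table n = tabulate n f by case: n => [|n]; eexists.
rewrite /ncavN sumE tE /tabulate !big_flatten big_map /ncav count_codesS.
rewrite [index_iota _ _]/index_iota subn0; apply: eq_big_seq => x1.
rewrite mem_iota => x1n.
rewrite big_map count_codesS /index_iota subn0; apply: eq_big_seq => x2.
rewrite mem_iota => x2n.
rewrite big_map count_codesS /index_iota subn0; apply: eq_big_seq => x3.
rewrite mem_iota => x3n.
by rewrite -[RHS]/(ncav_from3 n x1 x2 x3) -tableE // tE lookup_tabulate.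
Qed.

End Table.

(* [bad w] with the positions of the letters of [w] precomputed in [inv]; the
   last letter is only searched for when the first four are in the right order. *)
Definition bad_fast (inv : seq nat) n x1 x2 x3 x4 : bool :=
  let u := [:: x1; bump x1 x2; bump x1 (bump x2 x3); bump x1 (bump x2 (bump x3 x4))] in
  if sorted ltn [seq nth 0 u i | i <- inv & i < 4] then
    has (fun e => sorted ltn [seq nth 0 (rcons u e) i | i <- inv]) (iota 0 n)
  else false.

(** An increasing sequence stays increasing when the fifth letter is erased, so the early test
    discards no occurrence. *)
Lemma bad_fastE w n x1 x2 x3 x4 : size w = 5 ->
  bad_fast [seq index k w | k <- iota 1 5] n x1 x2 x3 x4 = bad w n x1 x2 x3 x4.
Proof.
move=> sw; rewrite /bad /bad_fast; set inv := [seq index k w | k <- iota 1 5].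
set u := [:: x1; bump x1 x2; _; _].
have occE e : occurs w (rcons u e) = sorted ltn [seq nth 0 (rcons u e) i | i <- inv].
  by rewrite /occurs sw /inv -map_comp.
case: ifP => [_|/negbT unsorted]; first by apply: eq_has => e; rewrite -occE.
apply/esym/hasPn => e _; apply: contra unsorted.
rewrite -[[:: x1; _; _; _; e]]/(rcons u e) occE => /(subseq_sorted ltn_trans); apply.
have -> : [seq nth 0 u i | i <- inv & i < 4] =
          [seq nth 0 (rcons u e) i | i <- inv & i < 4].
  by apply/eq_in_map => i; rewrite mem_filter => /andP [i4 _]; rewrite nth_rcons i4.
by apply: map_subseq; apply: filter_subseq.
Qed.

Definition navN w n : N := ncavN (bad_fast [seq index k w | k <- iota 1 5]) n.

Lemma navNE w n : perm_eq w (iota 1 5) -> nav w n.+3 = nat_of_bin (navN w n).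
Proof.
move=> wP; rewrite /navN ncavNE nav_codes //; apply: eq_ncav => m x1 x2 x3 x4 _ _ _ _.
by rewrite bad_fastE // (perm_size wP).
Qed.

(** The argument 7 stands for length 10, since [navN w n] counts words of length [n.+3]. *)
Lemma uniq_navN : uniq [seq navN (head [::] c) 7 | c <- class_table].
Proof. by vm_compute. Qed.

(** * The classes *)

(** Complementing within 1, ..., 4 and then within 1, ..., 5 adds one to every letter: abcd-5
    becomes the same order of adjacent letters followed by a smallest letter. *)
Lemma nav_bottom w n : perm_eq w (iota 1 4) ->
  nav (complement (rcons (compl w) 5)) n = nav (rcons w 5) n.
Proof.
move=> wP; rewrite nav_complement ?nav_compl //.
rewrite -cats1 -[iota 1 5]/(iota 1 4 ++ [:: 5]) perm_cat2r.
by rewrite /compl (perm_size wP); apply: (perm_trans (perm_map _ wP)).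
Qed.

Section ClassEquations.

Variable n : nat.

Let nav13542 : nav [:: 1; 3; 5; 4; 2] n = nav [:: 1; 2; 5; 4; 3] n.
Proof.
by apply/esym; apply: nav_exchange2 => // x1 x2 x3 x4 x5; rewrite /occurs /=; lia.
Qed.

Let nav15432 : nav [:: 1; 5; 4; 3; 2] n = nav [:: 1; 4; 5; 3; 2] n.
Proof. exact: nav_swap23. Qed.

Let nav21453 : nav [:: 2; 1; 4; 5; 3] n = nav [:: 2; 1; 3; 5; 4] n.
Proof.
by apply/esym; apply: nav_exchange3 => // x1 x2 x3 x4 x5; rewrite /occurs /=; lia.
Qed.

Let nav12534 : nav [:: 1; 2; 5; 3; 4] n = nav [:: 1; 2; 4; 3; 5] n.
Proof.
by apply/esym; apply: nav_exchange3 => // x1 x2 x3 x4 x5; rewrite /occurs /=; lia.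
Qed.

(** 2134 is the complement of 3421, which is the reversal of 1243. *)
Let nav21345 : nav [:: 2; 1; 3; 4; 5] n = nav [:: 1; 2; 4; 3; 5] n.
Proof.
by rewrite (@nav_compl [:: 3; 4; 2; 1]) // (@nav_rev [:: 1; 2; 4; 3]).
Qed.

Let nav23541 : nav [:: 2; 3; 5; 4; 1] n = nav [:: 1; 2; 4; 3; 5] n.
Proof. exact: (@nav_bottom [:: 1; 2; 4; 3]). Qed.

Let nav32451 : nav [:: 3; 2; 4; 5; 1] n = nav [:: 1; 2; 4; 3; 5] n.
Proof. by rewrite (@nav_bottom [:: 2; 1; 3; 4]) // nav21345. Qed.

Let nav31452 : nav [:: 3; 1; 4; 5; 2] n = nav [:: 1; 2; 4; 3; 5] n.
Proof.
rewrite -nav32451; apply: nav_exchange2 => // x1 x2 x3 x4 x5; rewrite /occurs /=; lia.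
Qed.

Let nav32154 : nav [:: 3; 2; 1; 5; 4] n = nav [:: 3; 1; 2; 5; 4] n.
Proof. exact: nav_swap23. Qed.

(** In class L, block symmetries and swaps link the patterns ending in 5, exchanges and swaps reach
    those ending in 4 or 3, and [nav_bottom] those ending in 1. *)
Let nav32145 : nav [:: 3; 2; 1; 4; 5] n = nav [:: 3; 1; 2; 4; 5] n.
Proof. exact: nav_swap23. Qed.

Let nav24315 : nav [:: 2; 4; 3; 1; 5] n = nav [:: 3; 1; 2; 4; 5] n.
Proof. exact: (@nav_compl [:: 3; 1; 2; 4]). Qed.

Let nav23415 : nav [:: 2; 3; 4; 1; 5] n = nav [:: 3; 1; 2; 4; 5] n.
Proof. by rewrite -nav24315; apply: nav_swap23. Qed.

Let nav13425 : nav [:: 1; 3; 4; 2; 5] n = nav [:: 3; 1; 2; 4; 5] n.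
Proof. by rewrite (@nav_rev [:: 2; 4; 3; 1]) // nav24315. Qed.

Let nav14325 : nav [:: 1; 4; 3; 2; 5] n = nav [:: 3; 1; 2; 4; 5] n.
Proof. by rewrite -nav13425; apply: nav_swap23. Qed.

Let nav13524 : nav [:: 1; 3; 5; 2; 4] n = nav [:: 3; 1; 2; 4; 5] n.
Proof.
rewrite -nav13425; apply/esym.
by apply: nav_exchange3 => // x1 x2 x3 x4 x5; rewrite /occurs /=; lia.
Qed.

Let nav14523 : nav [:: 1; 4; 5; 2; 3] n = nav [:: 3; 1; 2; 4; 5] n.
Proof.
rewrite -nav13524; apply/esym.
by apply: nav_exchange2 => // x1 x2 x3 x4 x5; rewrite /occurs /=; lia.
Qed.

Let nav15324 : nav [:: 1; 5; 3; 2; 4] n = nav [:: 3; 1; 2; 4; 5] n.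
Proof. by rewrite -nav13524; apply: nav_swap23. Qed.

Let nav15423 : nav [:: 1; 5; 4; 2; 3] n = nav [:: 3; 1; 2; 4; 5] n.
Proof. by rewrite -nav14523; apply: nav_swap23. Qed.

Let nav23514 : nav [:: 2; 3; 5; 1; 4] n = nav [:: 3; 1; 2; 4; 5] n.
Proof.
rewrite -nav23415; apply/esym.
by apply: nav_exchange3 => // x1 x2 x3 x4 x5; rewrite /occurs /=; lia.
Qed.

Let nav24513 : nav [:: 2; 4; 5; 1; 3] n = nav [:: 3; 1; 2; 4; 5] n.
Proof.
rewrite -nav23514; apply/esym.
by apply: nav_exchange2 => // x1 x2 x3 x4 x5; rewrite /occurs /=; lia.
Qed.

Let nav25314 : nav [:: 2; 5; 3; 1; 4] n = nav [:: 3; 1; 2; 4; 5] n.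
Proof. by rewrite -nav23514; apply: nav_swap23. Qed.

Let nav25413 : nav [:: 2; 5; 4; 1; 3] n = nav [:: 3; 1; 2; 4; 5] n.
Proof. by rewrite -nav24513; apply: nav_swap23. Qed.

Let nav25431 : nav [:: 2; 5; 4; 3; 1] n = nav [:: 3; 1; 2; 4; 5] n.
Proof. by rewrite (@nav_bottom [:: 1; 4; 3; 2]) // nav14325. Qed.

Let nav24531 : nav [:: 2; 4; 5; 3; 1] n = nav [:: 3; 1; 2; 4; 5] n.
Proof. by rewrite (@nav_bottom [:: 1; 3; 4; 2]) // nav13425. Qed.

Let nav31542 : nav [:: 3; 1; 5; 4; 2] n = nav [:: 2; 1; 5; 3; 4] n.
Proof. by rewrite nav21534. Qed.

Let nav32415 : nav [:: 3; 2; 4; 1; 5] n = nav [:: 1; 4; 2; 3; 5] n.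
Proof. exact: (@nav_rev [:: 1; 4; 2; 3]). Qed.

Let nav23145 : nav [:: 2; 3; 1; 4; 5] n = nav [:: 1; 4; 2; 3; 5] n.
Proof. by rewrite (@nav_compl [:: 3; 2; 4; 1]) // nav32415. Qed.

Let nav25341 : nav [:: 2; 5; 3; 4; 1] n = nav [:: 1; 4; 2; 3; 5] n.
Proof. exact: (@nav_bottom [:: 1; 4; 2; 3]). Qed.

Let nav32541 : nav [:: 3; 2; 5; 4; 1] n = nav [:: 2; 1; 4; 3; 5] n.
Proof. exact: (@nav_bottom [:: 2; 1; 4; 3]). Qed.

Let nav24351 : nav [:: 2; 4; 3; 5; 1] n = nav [:: 1; 3; 2; 4; 5] n.
Proof. exact: (@nav_bottom [:: 1; 3; 2; 4]). Qed.

Let nav31425 : nav [:: 3; 1; 4; 2; 5] n = nav [:: 2; 4; 1; 3; 5] n.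
Proof. exact: (@nav_compl [:: 2; 4; 1; 3]). Qed.

Let nav12453' : nav [:: 1; 2; 4; 5; 3] n = nav [:: 1; 2; 3; 5; 4] n.
Proof. by rewrite nav12354. Qed.

Let nav13452 : nav [:: 1; 3; 4; 5; 2] n = nav [:: 1; 2; 3; 5; 4] n.
Proof. by rewrite nav12354 nav12453. Qed.

Let nav23451 : nav [:: 2; 3; 4; 5; 1] n = nav [:: 1; 2; 3; 4; 5] n.
Proof. exact: (@nav_bottom [:: 1; 2; 3; 4]). Qed.

Lemma nav_head c w : c \in class_table -> w \in c -> nav w n = nav (head [::] c) n.
Proof.
move=> cT wc.
have : all (fun c => all (fun w => nav w n == nav (head [::] c) n) c) class_table.
  rewrite /= nav13542 nav15432 nav21453 nav12534 nav21345 nav23541 nav31452 nav32451.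
  rewrite nav32154 nav32145 nav25431 nav24531 nav23415 nav24315 nav13425 nav14325.
  rewrite nav13524 nav14523 nav15324 nav15423 nav25314 nav25413 nav23514 nav24513.
  rewrite nav31542 nav23145 nav25341 nav32415 nav32541 nav24351 nav31425.
  by rewrite nav12453' nav13452 nav23451 !eqxx.
by move/allP => /(_ c cT) /allP /(_ w wc) /eqP.
Qed.

End ClassEquations.

(** * From the table to all 120 patterns *)

Definition class_words (c : seq (seq nat)) := c ++ [seq complement w | w <- c].

Lemma class_table_perm c w : c \in class_table -> w \in class_words c ->
  perm_eq w (iota 1 5).
Proof.
move=> cT wc.
have : all (fun c => all (fun w => perm_eq w (iota 1 5)) (class_words c))
  class_table.
  by vm_compute.
by move/allP => /(_ c cT) /allP /(_ w wc).
Qed.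

Lemma class_nav c w n : c \in class_table -> w \in class_words c ->
  nav w n = nav (head [::] c) n.
Proof.
move=> cT; rewrite mem_cat => /orP [wc|/mapP [v vc ->]]; first exact: nav_head.
rewrite nav_complement ?(nav_head n cT vc) //.
by apply: (class_table_perm cT); rewrite mem_cat vc.
Qed.

Lemma class_table_cover w : perm_eq w (iota 1 5) ->
  exists2 c, c \in class_table & w \in class_words c.
Proof.
rewrite -mem_permutations => wP; apply/hasP.
have : all (fun w => has (fun c => w \in class_words c) class_table)
  (permutations (iota 1 5)).
  by vm_compute.
by move/allP => /(_ w wP).
Qed.

Lemma uniq_map_inj (T1 T2 : eqType) (f : T1 -> T2) (s : seq T1) :
  uniq (map f s) -> {in s &, injective f}.
Proof.
elim: s => //= x s IHs /andP [fx us] y z; rewrite !inE.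
case/predU1P => [->|ys] /predU1P [->|zs] // eqf; last exact: IHs us _ _ ys zs eqf.
  by rewrite eqf map_f in fx.
by rewrite -eqf map_f in fx.
Qed.

(** Each count agrees with that of the head of the class, so the distinct values of the heads at
    length 10 decide. *)
Lemma class_separated c c' w w' : c \in class_table -> c' \in class_table ->
  w \in class_words c -> w' \in class_words c' ->
  (forall n, 0 < n -> nav w n = nav w' n) -> c = c'.
Proof.
move=> cT cT' wc wc' /(_ 10 isT); rewrite (class_nav 10 cT wc) (class_nav 10 cT' wc').
have head_perm d : d \in class_table -> perm_eq (head [::] d) (iota 1 5).
  move=> dT; apply: (class_table_perm dT); rewrite mem_cat.
  have : all (fun d => head [::] d \in d) class_table by vm_compute.
  by move/allP => /(_ d dT) ->.
rewrite !navNE ?head_perm // => /(can_inj nat_of_binK) eqN.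
by apply: (uniq_map_inj uniq_navN).
Qed.

Lemma perm_one_line (s : 'S_5) : perm_eq (one_line s) (iota 1 5).
Proof. by rewrite one_lineE (perm_trans (perm_map _ (word_perm_iota s))). Qed.

Lemma one_line_surj w : perm_eq w (iota 1 5) -> exists s : 'S_5, one_line s = w.
Proof.
move=> wP; have : map predn w \in permutations (iota 0 5).
  by rewrite mem_permutations (perm_trans (perm_map _ wP)).
rewrite (perm_mem (perm_words 5)) => /mapP [s _ wE]; exists s.
rewrite one_lineE -wE -map_comp map_id_in // => x /=.
by rewrite (perm_mem wP) mem_iota => /andP [x0 _]; rewrite prednK.
Qed.

Lemma wilf_equivP (s t : 'S_5) c : c \in class_table -> one_line s \in class_words c ->
  wilf_equiv s t <-> one_line t \in class_words c.
Proof.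
move=> cT sc; split=> [st|tc n _]; last first.
  by rewrite !card_avoiders (class_nav n cT sc) (class_nav n cT tc).
have [c' cT' tc'] := class_table_cover (perm_one_line t).
suff -> : c = c' by [].
by apply: (class_separated cT cT' sc tc') => n /st; rewrite !card_avoiders.
Qed.

Lemma mem_table_class (s : 'S_5) c :
  (s \in table_class c) = (one_line s \in class_words c).
Proof. by rewrite inE. Qed.

Lemma mem_listed_classes (A : {set 'S_5}) :
  reflect (exists2 c, c \in class_table & A = table_class c) (A \in listed_classes).
Proof. by rewrite inE; apply: mapP. Qed.

Lemma head_class c : c \in class_table ->
  exists2 s : 'S_5, one_line s = head [::] c & s \in table_class c.
Proof.
move=> cT; have hc : head [::] c \in class_words c.
  have : all (fun d => head [::] d \in class_words d) class_table by vm_compute.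
  by move/allP => /(_ c cT).
have [s sE] := one_line_surj (class_table_perm cT hc).
by exists s; rewrite // mem_table_class sE.
Qed.

Theorem theorem1p9 :
  [/\ #|listed_classes| = 26,
      (forall A : {set 'S_5}, wilf_class A <-> A \in listed_classes)
    & (forall s t : 'S_5,
         wilf_equiv s t <->
         exists A : {set 'S_5}, [/\ A \in listed_classes, s \in A & t \in A])].
Proof.
split.
- have uT : uniq [seq table_class c | c <- class_table].
    rewrite map_inj_in_uniq; first by vm_compute.
    (* Equal sets share the head of the first class, and no word belongs to two classes. *)
    move=> c c' cT cT' eqc; have [s _ sc] := head_class cT.
    apply: (class_separated cT cT' (w := one_line s) (w' := one_line s)) => //.
      by rewrite -mem_table_class.
    by rewrite -mem_table_class -eqc.
  by rewrite cardsE (card_uniqP uT) size_map.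
- move=> A; split=> [[s As]|/mem_listed_classes [c cT ->]].
    have [c cT sc] := class_table_cover (perm_one_line s).
    apply/mem_listed_classes; exists c => //; apply/setP => t.
    rewrite mem_table_class; apply/idP/idP => [/As|tc].
      by move/(wilf_equivP t cT sc).
    by apply/As/(wilf_equivP t cT sc).
  have [s _] := head_class cT; rewrite mem_table_class => sc.
  by exists s => t; rewrite mem_table_class; apply: iff_sym; apply: wilf_equivP.
- move=> s t; split=> [st|[A [/mem_listed_classes [c cT ->]]]].
    have [c cT sc] := class_table_cover (perm_one_line s).
    exists (table_class c); rewrite !mem_table_class sc; split=> //.
      by apply/mem_listed_classes; exists c.
    by apply/(wilf_equivP t cT sc).
  by rewrite !mem_table_class => sc tc; apply/(wilf_equivP t cT sc).
Qed.
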